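(* Let $(a_n)_{n\in\mathbb{N}}$ be a sequence of positive integers with $\frac{a_{n+1}}{a_n}\in\{2,3,\ldots\}$ for every $n\in\mathbb{N}$. Let $f\not\equiv 0$ be an even real trigonometric polynomial with $\int_0^1 f(x)\,dx=0$, i.e. $f(x)=\sum_{d=-D}^{D}c_d e^{2\pi i d x}$ with $D\in\mathbb{N}$, $c_d\in\mathbb{R}$, $c_d=c_{-d}$ for all $d$, $c_0=0$, and not all $c_d$ equal to $0$. Let $U$ be uniformly distributed on $[0,1]$ and $S_n^f=\sum_{j=1}^n f(a_jU)$. Assume that there is a constant $c(f,a)\in(0,\infty)$, depending only on $f$ and the sequence $a=(a_n)_{n\in\mathbb{N}}$, such that $$\mathbb{E}(S_n^f)^2\ge c(f,a)\,n\qquad\text{for every } n\in\mathbb{N}.$$ Let $(z_n)_{n\in\mathbb{N}}$ be a sequence of positive numbers converging to $0$ such that, as $n\to\infty$, $$z_n n\to\infty\qquad\text{and}\qquad z_n(\log n)^2\to 0.$$ Put $x_n=z_n\,\mathbb{E}(S_n^f)^2$ and $y_n=\sqrt{z_n}\,\mathbb{E}(S_n^f)^2$. Then $\left(\frac{S_n^f}{y_n}\right)_{n\in\mathbb{N}}$ satisfies a moderate deviation principle with speed $x_n$ and good rate function $I(t)=\frac{t^2}{2}$.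
   Context: A sequence $(Z_n)_{n\in\mathbb{N}}$ of real random variables satisfies a large deviation principle with speed $x_n$ and good rate function $I:\mathbb{R}\to[0,\infty]$ if and only if $x_n>0$, $\lim_{n\to\infty}x_n=\infty$, all sublevel sets of $I$ are compact, and for every Borel set $B\subseteq\mathbb{R}$, $$-\inf_{t\in\operatorname{int}B}I(t)\le\liminf_{n\to\infty}\frac1{x_n}\log\mathbb{P}(Z_n\in B)\le\limsup_{n\to\infty}\frac1{x_n}\log\mathbb{P}(Z_n\in B)\le-\inf_{t\in\overline{B}}I(t),$$ where $\operatorname{int}B$ is the interior and $\overline B$ the closure of $B$. When $Z_n=S_n/y_n$ with $S_n$ a sum of $n$ random variables and $y_n\to\infty$ slower than $n$ but faster than $\sqrt n$, one says ''moderate deviation principle'' for the very same property. *)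

(* Defs.v *)
(* MathComp-Analysis; R[i] comes from mathcomp-real-closed. *)
From HB Require Import structures.
From mathcomp Require Export all_boot all_order all_algebra.
From mathcomp Require Export all_classical all_reals all_analysis.
From mathcomp Require Export complex.

Set Implicit Arguments.
Unset Strict Implicit.
Unset Printing Implicit Defensive.

Import Order.TTheory GRing.Theory Num.Theory.
Import numFieldNormedType.Exports.

Local Open Scope classical_set_scope.
Local Open Scope ring_scope.

(* e^{2 pi i d x} *)
Definition expi2pi (R : realType) (d : int) (x : R) : R[i] :=
  Complex (cos (2 * pi * d%:~R * x)) (sin (2 * pi * d%:~R * x)).

(* The frequency d runs over -D, ..., D through d = k - D with 0 <= k <= 2D;
   values of c outside this range are irrelevant. *)
Definition even_real_trigpoly (R : realType) (f : R -> R) : Prop :=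
  exists (D : nat) (c : int -> R),
    [/\ (0 < D)%N,
        forall d : int, `|d| <= D%:Z -> c d = c (- d) &
        forall x : R, real_complex R (f x) =
          \sum_(k < D.*2.+1)
            real_complex R (c (k%:Z - D%:Z)) * expi2pi (k%:Z - D%:Z) x].

(* Sequences indexed by the positive integers are functions on nat whose value
   at 0 is ignored. *)
Definition lacunary_sum (R : realType) (f : R -> R) (a : nat -> nat)
    (n : nat) (u : R) : R :=
  \sum_(1 <= j < n.+1) f ((a j)%:R * u).

(* Sublevel sets are taken at finite levels. With ereal_inf set0 = +oo and
   lne 0 = -oo, empty interiors and null events follow the usual conventions. *)
Definition LDP d (T : measurableType d) (R : realType) (P : probability T R)
    (Z : nat -> T -> R) (x : nat -> R) (I : R -> \bar R) : Prop :=
  [/\ forall n, (0 < n)%N -> measurable_fun setT (Z n),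
      (forall n, (0 < n)%N -> 0 < x n) /\ x n @[n --> \oo] --> +oo,
      forall t, (0 <= I t)%E,
      forall s : R, compact [set t | (I t <= s%:E)%E] &
      forall B : set R, measurable B ->
        let u n := ((x n)^-1%:E * lne (P (Z n @^-1` B)))%E in
        [/\ (- ereal_inf (I @` interior B) <= limn_einf u)%E,
            (limn_einf u <= limn_esup u)%E &
            (limn_esup u <= - ereal_inf (I @` closure B))%E]].

(* An LDP for S_n / y_n whose normalization lies strictly between sqrt n
   and n. *)
Definition MDP d (T : measurableType d) (R : realType) (P : probability T R)
    (S : nat -> T -> R) (y x : nat -> R) (I : R -> \bar R) : Prop :=
  [/\ y n @[n --> \oo] --> +oo,
      y n / n%:R @[n --> \oo] --> (0 : R),
      y n / Num.sqrt n%:R @[n --> \oo] --> +oo &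
      LDP P (fun n w => S n w / y n) x I].

(* Main.v *)
(* For u uniform on [0, 1] and phi a function of a_1 u, ..., a_m u, the
   conditional expectation of phi given a_{m+1} u mod 1 is computed by the
   transfer operators g |-> (1/q) sum_{k<q} g((v+k)/q), q = a_{j+1}/a_j, and each
   of them divides Lipschitz constants by q >= 2.  Put g = t f with t small.  The
   normalised conditional expectation rho_m of exp(g(a_1 u) + ... + g(a_{m-1} u))
   given a_m u mod 1 then equals 1 + H_m + O(t^2) in Lipschitz norm, uniformly in
   m, where H_m is the conditional expectation of g(a_1 u) + ... + g(a_{m-1} u).
   Integrating rho_m exp(g), the log-Laplace transform grows at each step by
   int g^2 / 2 + int H_m g + O(t^3), whose first two terms are exactly the growth
   of half the second moment.  Hence
     log E exp(t S_n) = t^2 E S_n^2 / 2 + O(n |t|^3).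
   With t = l sqrt(z_n) the error is o(z_n n) = o(x_n), so the scaled cumulant
   generating functions converge to l^2 / 2, and Chernoff bounds together with
   exponential tilting give the two large deviation bounds. *)
Require Import Defs.
From HB Require Import structures.
From mathcomp Require Import measurable_realfun ring lra.
Import Order.TTheory GRing.Theory Num.Theory.
Import numFieldNormedType.Exports.
Local Open Scope classical_set_scope.
Local Open Scope ring_scope.

Set Implicit Arguments.
Unset Strict Implicit.
Unset Printing Implicit Defensive.

(** * The transfer operator *)

Definition mean (R : realType) (g : R -> R) : R :=
  Rintegral (@lebesgue_measure R) `[0, 1] g.

Lemma continuous_itv_integrable (R : realType) (g : R -> R) (a b : R) :
  continuous g -> (@lebesgue_measure R).-integrable `[a, b] (EFin \o g).
Proof.
move=> cg; apply: continuous_compact_integrable; first exact: segment_compact.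
exact: continuous_subspaceT.
Qed.

Lemma continuous_sqr (R : realType) (h : R -> R) :
  continuous h -> continuous (fun x => h x ^+ 2).
Proof.
move=> ch x; rewrite (_ : (fun x => _) = (fun x => h x * h x)).
  by apply: cvgM; exact: ch.
by apply/funext => y; rewrite expr2.
Qed.

Lemma eq_mean (R : realType) (g h : R -> R) : g =1 h -> mean g = mean h.
Proof. by move=> gh; apply: eq_Rintegral => x _. Qed.

Lemma mean_cst (R : realType) (r : R) : mean (fun _ : R => r) = r.
Proof.
rewrite /mean Rintegral_cst//= lebesgue_measure_itv/= lte01 -EFinD/=.
by rewrite subr0 mulr1.
Qed.

Lemma meanD (R : realType) (g h : R -> R) : continuous g -> continuous h ->
  mean (fun x => g x + h x) = mean g + mean h.
Proof.
by move=> cg ch; apply: RintegralD => //; exact: continuous_itv_integrable.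
Qed.

Lemma meanZ (R : realType) (r : R) (g : R -> R) : continuous g ->
  mean (fun x => r * g x) = r * mean g.
Proof.
by move=> cg; apply: RintegralZl => //; exact: continuous_itv_integrable.
Qed.

Lemma ler_mean (R : realType) (g h : R -> R) : continuous g -> continuous h ->
  (forall x, 0 <= x <= 1 -> g x <= h x) -> mean g <= mean h.
Proof.
move=> cg ch gh; by apply: le_Rintegral => //; exact: continuous_itv_integrable.
Qed.

Lemma ler_norm_mean (R : realType) (g : R -> R) (M : R) : continuous g ->
  (forall x, 0 <= x <= 1 -> `|g x| <= M) -> `|mean g| <= M.
Proof.
move=> cg gM; rewrite ler_norml; apply/andP; split.
- rewrite -[leLHS]mean_cst; apply: ler_mean => // [?|x x01]; first exact: cvg_cst.
  by have := gM _ x01; rewrite ler_norml => /andP[].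
- rewrite -[leRHS]mean_cst; apply: ler_mean => // [?|x x01]; first exact: cvg_cst.
  by have := gM _ x01; rewrite ler_norml => /andP[].
Qed.

Lemma mean_sum (R : realType) (n : nat) (g : nat -> R -> R) :
  (forall k, continuous (g k)) ->
  continuous (fun x => \sum_(k < n) g k x) /\
  mean (fun x => \sum_(k < n) g k x) = \sum_(k < n) mean (g k).
Proof.
move=> cg; elim: n => [|n [cn IH]].
  rewrite big_ord0; split.
    by under eq_fun do rewrite big_ord0; move=> ?; exact: cvg_cst.
  by rewrite -[RHS]mean_cst; apply: eq_mean => x; rewrite big_ord0.
rewrite big_ord_recr/= -IH -meanD//; split.
  under eq_fun do rewrite big_ord_recr/=.
  by move=> x; apply: cvgD; [exact: cn|exact: cg].
by apply: eq_mean => x; rewrite big_ord_recr.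
Qed.

(** Increasing affine substitution: v -> (v + k) / q carries [0, 1] onto the piece and has constant
    derivative 1 / q. *)
Lemma Rintegral_piece (R : realType) (q k : nat) (G : R -> R) :
  (0 < q)%N -> continuous G ->
  Rintegral (@lebesgue_measure R) `[k%:R / q%:R, k.+1%:R / q%:R] G =
  q%:R^-1 * mean (fun v => G ((v + k%:R) / q%:R)).
Proof.
move=> q0 cG.
pose F := fun v : R => (v + k%:R) / q%:R.
have dF' (x : R) : is_derive x 1 F q%:R^-1.
  have dk : is_derive x 1 (fun v : R => v + k%:R) (1 + 0).
    by apply: is_deriveD.
  have -> : F = (q%:R^-1 : R) \*: (fun v : R => v + k%:R).
    by apply/funext => v; rewrite /F/= mulrC.
  by apply: is_derive_eq; rewrite addr0 /GRing.scale/= mulr1.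
have F' : derive1 F = cst (q%:R^-1 : R).
  by apply/funext => x; rewrite derive1E; exact: derive_val.
have cF : continuous F.
  move=> x; apply: cvgMr_tmp; apply: cvgD; [exact: cvg_id|exact: cvg_cst].
have dF x : derivable F x 1 by apply: ex_derive.
have F0 : F 0 = k%:R / q%:R by rewrite /F add0r.
have F1 : F 1 = k.+1%:R / q%:R by rewrite /F nat1r.
rewrite /mean /Rintegral -F0 -F1.
rewrite integration_by_substitution_increasing//.
- rewrite -RintegralZl//; last first.
    apply: continuous_itv_integrable => x; apply: cvg_comp; [exact: cF|exact: cG].
  by congr fine; apply: eq_integral => x _; rewrite F' /= mulrC.
- by move=> x y _ _ xy; rewrite /F ltr_pM2r ?invr_gt0 ?ltr0n// ltrD2r.
- by rewrite F' => x _; exact: cvg_cst.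
- by rewrite F'; exact: is_cvg_cst.
- by rewrite F'; exact: is_cvg_cst.
- split; first by move=> x _; exact: dF.
  + exact/cvg_at_right_filter/cF.
  + exact/cvg_at_left_filter/cF.
- exact: continuous_subspaceT.
Qed.

Lemma mean_pieces (R : realType) (q : nat) (G : R -> R) :
  (0 < q)%N -> continuous G ->
  mean G = \sum_(k < q) q%:R^-1 * mean (fun v => G ((v + k%:R) / q%:R)).
Proof.
move=> q0 cG.
(* The induction runs over the partial integrals up to m / q, with q fixed; the claim is the case m
   = q. *)
have H m : Rintegral (@lebesgue_measure R) `[0, m%:R / q%:R] G =
    \sum_(k < m) q%:R^-1 * mean (fun v => G ((v + k%:R) / q%:R)).
  elim: m => [|m IH]; first by rewrite big_ord0 mul0r set_itv1 Rintegral_set1.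
  rewrite big_ord_recr/= -IH -Rintegral_piece//.
  have le1 : m%:R / q%:R <= m.+1%:R / q%:R :> R.
    by rewrite ler_pM2r ?invr_gt0 ?ltr0n// ler_nat.
  have le0 : 0 <= m%:R / q%:R :> R by rewrite divr_ge0.
  (* The new piece is opened at its left endpoint, a null set, so that it becomes the difference of
     two integrals starting at 0. *)
  rewrite -(@Rintegral_itv_obnd_cbnd _ (m%:R / q%:R)); last first.
    apply: integrableS 
      (continuous_itv_integrable (m%:R / q%:R) (m.+1%:R / q%:R) cG) => //.
    by apply: subset_itvr; rewrite bnd_simp.
  rewrite -(@Rintegral_itvB _ G (BLeft 0) (BRight (m.+1%:R / q%:R)) (m%:R / q%:R)).
  - by rewrite addrC subrK.
  - exact: continuous_itv_integrable.
  - by rewrite bnd_simp.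
  - by rewrite bnd_simp.
by rewrite -H divff// pnatr_eq0 -lt0n.
Qed.

(** The Perron-Frobenius operator of u -> q u mod 1 for Lebesgue measure. *)
Definition transfer (R : realType) (q : nat) (g : R -> R) (v : R) : R :=
  q%:R^-1 * \sum_(k < q) g ((v + k%:R) / q%:R).

Lemma continuous_transfer (R : realType) (q : nat) (g : R -> R) :
  continuous g -> continuous (transfer q g).
Proof.
move=> cg x; apply: cvgMl_tmp.
apply: (proj1 (mean_sum q (g := fun k v => g ((v + k%:R) / q%:R)) _)) => k y.
apply: (@cvg_comp _ _ _ (fun v : R => (v + k%:R) / q%:R) g); last exact: cg.
by apply: cvgMr_tmp; apply: cvgD; [exact: cvg_id|exact: cvg_cst].
Qed.

Lemma periodic_nat (R : realType) (psi : R -> R) (k : nat) (x : R) :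
  (forall x, psi (x + 1) = psi x) -> psi (x + k%:R) = psi x.
Proof.
move=> p; elim: k => [|k IH]; first by rewrite addr0.
by rewrite -natr1 addrA p.
Qed.

(** On the k-th piece u = (v + k) / q, so q u = v + k and periodicity of [psi] removes k. This
    duality is what makes [transfer] a conditional expectation. *)
Lemma mean_transfer (R : realType) (q : nat) (g psi : R -> R) :
  (0 < q)%N -> continuous g -> continuous psi ->
  (forall x, psi (x + 1) = psi x) ->
  mean (fun u => g u * psi (q%:R * u)) = mean (fun v => transfer q g v * psi v).
Proof.
move=> q0 cg cpsi p.
have q0R : q%:R != 0 :> R by rewrite pnatr_eq0 -lt0n.
have cF k : continuous (fun v : R => (v + k%:R) / q%:R).
  by move=> x; apply: cvgMr_tmp; apply: cvgD; [exact: cvg_id|exact: cvg_cst].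
have cgk k : continuous (fun v : R => g ((v + k%:R) / q%:R)).
  move=> x; apply: (@cvg_comp _ _ _ (fun v : R => (v + k%:R) / q%:R) g).
    exact: cF.
  exact: cg.
rewrite (mean_pieces q0); last first.
  move=> x; apply: cvgM; first exact: cg.
  apply: (@cvg_comp _ _ _ (fun u : R => q%:R * u) psi); last exact: cpsi.
  by apply: cvgMl_tmp; exact: cvg_id.
rewrite -mulr_sumr.
have cM k : continuous (fun v : R => g ((v + k%:R) / q%:R) * psi v).
  by move=> x; apply: cvgM; [exact: cgk|exact: cpsi].
have [cS mS] := mean_sum q cM.
transitivity (q%:R^-1 * \sum_(k < q) mean (fun v : R => g ((v + k%:R) / q%:R) * psi v)).
  congr (_ * _); apply: eq_bigr => k _; apply: eq_mean => v.
  by congr (_ * _); rewrite mulrCA divff// mulr1 periodic_nat.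
rewrite -mS -meanZ//; apply: eq_mean => v.
by rewrite /transfer -mulr_suml mulrA.
Qed.

(** * Bounded Lipschitz functions on the unit interval *)

Lemma ler_dist_derive (R : realType) (h dh : R -> R) (e M x y : R) :
  (forall c : R, is_derive c (1 : R) h (dh c)) ->
  (forall c, `|c| <= e -> `|dh c| <= M) -> `|x| <= e -> `|y| <= e ->
  `|h x - h y| <= M * `|x - y|.
Proof.
move=> dhP dhM; wlog xy : x y / y <= x => [W xe ye|xe ye].
  have [/W|/ltW/W] := leP y x; first exact.
  by rewrite distrC (distrC x); exact.
have ch : {within `[y, x], continuous h}.
  apply: continuous_subspaceT => c; apply: differentiable_continuous.
  by apply/derivable1_diffP; apply: ex_derive.
have [c] := MVT_segment xy (fun c _ => dhP c) ch.
rewrite in_itv/= => /andP[yc cx] ->.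
rewrite normrM ler_wpM2r// dhM//.
by move: xe ye; rewrite !ler_norml => /andP[? ?] /andP[? ?]; apply/andP; split; lra.
Qed.

(** For s >= 0, exp(-s) >= 1 - s gives exp(s) <= 1 / (1 - s) <= 1 + 2 s, where the last step uses s
    <= 1/2. *)
Lemma norm_expR_sub1 (R : realType) (s : R) :
  `|s| <= 2^-1 -> `|expR s - 1| <= 2 * `|s|.
Proof.
move=> s2; have h1 := expR_ge1Dx s; have h2 := expR_ge1Dx (- s).
have e0 := expR_gt0 s; have eN : expR s * expR (- s) = 1 by rewrite -expRD subrr expR0.
have [s0|s0] := leP 0 s.
  rewrite (ger0_norm s0) in s2 *; rewrite ger0_norm; last by lra.
  by nra.
rewrite (ltr0_norm s0) in s2 *; rewrite ler_norml; apply/andP; split; first lra.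
by have := expR_le1 s; rewrite (ltW s0) => H; lra.
Qed.

Lemma ler_dist_expR1 (R : realType) (e x y : R) :
  e <= 2^-1 -> `|x| <= e -> `|y| <= e ->
  `|(expR x - 1 - x) - (expR y - 1 - y)| <= 2 * e * `|x - y|.
Proof.
move=> e2 xe ye.
apply: (@ler_dist_derive _ (fun s : R => expR s - 1 - s) (fun s => expR s - 1) e) => //.
  by move=> c; apply: is_derive_eq; rewrite subr0.
move=> c ce; apply: le_trans (norm_expR_sub1 _) _; first exact: le_trans ce e2.
by rewrite ler_pM2l.
Qed.

(** Mean value inequality between x and 0: the derivative exp(s) - 1 - s is at most 2 e^2 by the
    previous lemma. *)
Lemma ler_norm_expR2 (R : realType) (e x : R) : e <= 2^-1 -> `|x| <= e ->
  `|expR x - 1 - x - x ^+ 2 / 2| <= 2 * e ^+ 3.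
Proof.
move=> e2 xe; have e0 : 0 <= e := le_trans (normr_ge0 x) xe.
have := @ler_dist_derive _ (fun s : R => expR s - 1 - s - s ^+ 2 / 2)
  (fun s => expR s - 1 - s) e (2 * e ^+ 2) x 0.
rewrite expR0 normr0 expr0n/= mul0r !subr0 subrr subr0 => H.
apply: le_trans (H _ _ xe e0) _.
- move=> c; apply: is_derive_eq.
  by rewrite /GRing.scale/=; lra.
- move=> c ce; have := @ler_dist_expR1 _ e c 0 e2 ce.
  rewrite normr0 expR0 !subr0 subrr subr0 => /(_ e0) {}H; apply: le_trans H _.
  by rewrite expr2 mulrA ler_wpM2l// mulr_ge0.
- by rewrite [in leRHS]exprSr mulrA ler_wpM2l// mulr_ge0// exprn_ge0.
Qed.

(** The inequality ln(1 + y) <= y, used for 1 + x and for its inverse, puts ln(1 + x) between x / (1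
    + x) and x; the gap x^2 / (1 + x) is at most 2 x^2. *)
Lemma norm_ln1D (R : realType) (x : R) : `|x| <= 2^-1 ->
  `|ln (1 + x) - x| <= 2 * x ^+ 2.
Proof.
rewrite ler_norml => /andP[x1 x2].
have p : 0 < 1 + x by lra.
have h1 : ln (1 + x) <= x by apply: le_ln1Dx; lra.
have h2 : - ln (1 + x) <= (1 + x)^-1 - 1.
  rewrite -lnV ?posrE//; apply: le_trans (@le_ln1Dx _ ((1 + x)^-1 - 1) _).
    by rewrite subrKC.
  by have := p; rewrite -invr_gt0; lra.
have h3 : (1 + x) * (1 + x)^-1 = 1 by rewrite divff// gt_eqF.
rewrite ler_norml; apply/andP; split; last by nra.
have -> : ln (1 + x) = - - ln (1 + x) by rewrite opprK.
by move: h2 h3; set i := (1 + x)^-1 => h2 h3; nra.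
Qed.

(** The bounds are confined to [0, 1], which the branches (v + k) / q with k < q preserve;
    continuity is global, so that integrability and substitution come for free. *)
Record bounded_lipschitz (R : realType) (B L : R) (g : R -> R) : Prop :=
  BoundedLipschitz {
    bl_cont : continuous g;
    bl_bound : forall x, 0 <= x <= 1 -> `|g x| <= B;
    bl_lip : forall x y, 0 <= x <= 1 -> 0 <= y <= 1 ->
      `|g x - g y| <= L * `|x - y| }.

Lemma bl_le (R : realType) (B L B' L' : R) (g : R -> R) :
  B <= B' -> L <= L' ->
  bounded_lipschitz B L g -> bounded_lipschitz B' L' g.
Proof.
move=> BB LL [cg bg lg]; split => // [x x01|x y x01 y01].
  exact: le_trans (bg _ x01) BB.
by apply: le_trans (lg _ _ x01 y01) _; rewrite ler_wpM2r.
Qed.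

Lemma bl_eq (R : realType) (B L : R) (g h : R -> R) : g =1 h ->
  bounded_lipschitz B L g -> bounded_lipschitz B L h.
Proof. by move=> /funext ->. Qed.

Lemma bl_cst (R : realType) (r : R) : bounded_lipschitz `|r| 0 (fun _ : R => r).
Proof.
by split => [?| |x y]; [exact: cvg_cst| |rewrite subrr normr0 mul0r].
Qed.

Lemma bl_add (R : realType) (B1 L1 B2 L2 : R) (g h : R -> R) :
  bounded_lipschitz B1 L1 g -> bounded_lipschitz B2 L2 h ->
  bounded_lipschitz (B1 + B2) (L1 + L2) (fun x => g x + h x).
Proof.
move=> [cg bg lg] [ch bh lh]; split => [x|x x01|x y x01 y01].
- by apply: cvgD; [exact: cg|exact: ch].
- by rewrite (le_trans (ler_normD _ _))// lerD// ?bg ?bh.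
- by rewrite opprD addrACA (le_trans (ler_normD _ _))// mulrDl lerD// ?lg ?lh.
Qed.

Lemma bl_mul (R : realType) (B1 L1 B2 L2 : R) (g h : R -> R) :
  bounded_lipschitz B1 L1 g -> bounded_lipschitz B2 L2 h ->
  bounded_lipschitz (B1 * B2) (B1 * L2 + B2 * L1) (fun x => g x * h x).
Proof.
move=> [cg bg lg] [ch bh lh]; split => [x|x x01|x y x01 y01].
- by apply: cvgM; [exact: cg|exact: ch].
- by rewrite normrM ler_pM// ?bg ?bh.
- have -> : g x * h x - g y * h y = g x * (h x - h y) + h y * (g x - g y).
    by lra.
  rewrite (le_trans (ler_normD _ _))// mulrDl -!mulrA !normrM.
  by apply: lerD; apply: ler_pM => //; rewrite ?bg ?bh ?lg ?lh.
Qed.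

Lemma bl_scale (R : realType) (B L r : R) (g : R -> R) :
  bounded_lipschitz B L g ->
  bounded_lipschitz (`|r| * B) (`|r| * L) (fun x => r * g x).
Proof.
by move=> /(bl_mul (bl_cst r)); rewrite mulr0 addr0.
Qed.

(** The branches (x + k) / q map [0, 1] into itself and divide distances by q; averaging over k
    enlarges neither bound. This contraction drives all later inductions. *)
Lemma bl_transfer (R : realType) (B L : R) (q : nat) (g : R -> R) :
  (0 < q)%N -> bounded_lipschitz B L g ->
  bounded_lipschitz B (L / q%:R) (transfer q g).
Proof.
move=> q0 [cg bg lg].
have q0R : 0 < q%:R :> R by rewrite ltr0n.
have in01 (k : 'I_q) (x : R) : 0 <= x <= 1 -> 0 <= (x + k%:R) / q%:R <= 1.
  move=> /andP[x0 x1]; rewrite divr_ge0//=; last by rewrite addr_ge0.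
  rewrite ler_pdivrMr// mul1r; apply: (@le_trans _ _ (1 + k%:R)).
    by rewrite lerD2r.
  by rewrite nat1r ler_nat.
split => [|x x01|x y x01 y01]; first exact: continuous_transfer.
- rewrite /transfer normrM gtr0_norm ?invr_gt0//.
  rewrite ler_pdivrMl// (le_trans (ler_norm_sum _ _ _))//.
  rewrite (@le_trans _ _ (\sum_(k < q) B))//.
    by apply: ler_sum => k _; exact/bg/in01.
  by rewrite sumr_const card_ord mulr_natl.
- rewrite /transfer -mulrBr -sumrB normrM gtr0_norm ?invr_gt0//.
  rewrite ler_pdivrMl// (le_trans (ler_norm_sum _ _ _))//.
  rewrite (@le_trans _ _ (\sum_(k < q) (L / q%:R * `|x - y|)))//.
    apply: ler_sum => k _; apply: le_trans (lg _ _ (in01 k _ x01) (in01 k _ y01)) _.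
    have -> : (x + k%:R) / q%:R - (y + k%:R) / q%:R = (x - y) / q%:R by ring.
    rewrite normrM (gtr0_norm (x := q%:R^-1)) ?invr_gt0//.
    by rewrite mulrCA mulrC mulrAC.
  by rewrite sumr_const card_ord mulr_natl.
Qed.

(** Since g(x) is the mean over y of g(x) - g(y) and |x - y| <= 1, the Lipschitz constant also
    bounds the supremum. For centred functions only Lipschitz constants need to be tracked. *)
Lemma bl_mean0 (R : realType) (L : R) (g : R -> R) : continuous g ->
  (forall x y, 0 <= x <= 1 -> 0 <= y <= 1 -> `|g x - g y| <= L * `|x - y|) ->
  mean g = 0 -> bounded_lipschitz L L g.
Proof.
move=> cg lg g0; split => // x x01.
have -> : g x = mean (fun y => g x - g y).
  have := meanD (g := fun=> g x) (h := fun y => -1 * g y).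
  rewrite mean_cst meanZ// g0 mulr0 addr0 => H; rewrite -{1}H.
  - by apply: eq_mean => y; rewrite mulN1r.
  - by move=> ?; exact: cvg_cst.
  - by move=> y; apply: cvgMl_tmp; exact: cg.
apply: ler_norm_mean => [y|y y01].
  by apply: cvgB; [exact: cvg_cst|exact: cg].
apply: le_trans (lg _ _ x01 y01) _.
have L0 : 0 <= L.
  have := lg 0 1; rewrite lexx ler01/= lexx => /(_ isT isT).
  by rewrite sub0r normrN normr1 mulr1; exact: le_trans.
rewrite ler_piMr// ler_norml; move: x01 y01 => /andP[? ?] /andP[? ?].
by apply/andP; split; lra.
Qed.

Lemma bl_expR2 (R : realType) (e : R) (g : R -> R) : e <= 2^-1 ->
  bounded_lipschitz e e g ->
  bounded_lipschitz (2 * e ^+ 2) (2 * e ^+ 2) (fun x => expR (g x) - 1 - g x).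
Proof.
move=> e2 [cg bg lg].
have e0 : 0 <= e by apply: le_trans (normr_ge0 _) (bg 0 _); rewrite lexx ler01.
split => [x|x x01|x y x01 y01].
- apply: cvgB; last exact: cg.
  apply: cvgB; last exact: cvg_cst.
  by apply: cvg_comp; [exact: cg|exact: continuous_expR].
- have := @ler_dist_expR1 _ e (g x) 0 e2 (bg _ x01).
  rewrite normr0 expR0 !subr0 subrr subr0 => /(_ e0) {}H; apply: le_trans H _.
  by rewrite expr2 mulrA ler_wpM2l ?mulr_ge0// bg.
- apply: le_trans (ler_dist_expR1 e2 (bg _ x01) (bg _ y01)) _.
  by rewrite expr2 mulrA -(mulrA (2 * e)) ler_wpM2l ?mulr_ge0// lg.
Qed.

(** * The log-Laplace transform of a lacunary sum *)

Lemma mean_transfer1 (R : realType) (q : nat) (g : R -> R) :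
  (0 < q)%N -> continuous g -> mean (transfer q g) = mean g.
Proof.
move=> q0 cg; have := @mean_transfer _ q g (fun=> 1) q0 cg.
under eq_mean do rewrite mulr1; move=> -> //; last by move=> ?; exact: cvg_cst.
by apply: eq_mean => x; rewrite mulr1.
Qed.

Lemma transferD (R : realType) (q : nat) (g h : R -> R) :
  transfer q (fun x => g x + h x) =1 (fun v => transfer q g v + transfer q h v).
Proof. by move=> v; rewrite /transfer big_split/= mulrDr. Qed.

Lemma transfer_cst (R : realType) (q : nat) (r : R) : (0 < q)%N ->
  transfer q (fun=> r) =1 (fun=> r).
Proof.
move=> q0 v; rewrite /transfer sumr_const card_ord -[r *+ q]mulr_natl mulrA.
by rewrite mulVf ?mul1r// pnatr_eq0 -lt0n.
Qed.

(* [H] collects the terms of [rho] that are linear in the perturbation; the rest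
   is of second order also in Lipschitz norm, which is the norm contracted by
   [transfer]. *)
Record near_density (R : realType) (e : R) (H rho : R -> R) : Prop :=
  NearDensity {
    nd_first : bounded_lipschitz e e H;
    nd_first_mean : mean H = 0;
    nd_rest : bounded_lipschitz (10 * e ^+ 2) (10 * e ^+ 2)
                (fun x => rho x - 1 - H x);
    nd_cont : continuous rho;
    nd_mean : mean rho = 1 }.

(** [H + g] has Lipschitz constant 2 e, and q >= 2 brings it back to e; the supremum bound follows
    from the zero mean. *)
Lemma first_order_step (R : realType) (e : R) (q : nat) (g H : R -> R) :
  (1 < q)%N -> bounded_lipschitz e e g -> mean g = 0 ->
  bounded_lipschitz e e H -> mean H = 0 ->
  bounded_lipschitz e e (transfer q (fun x => H x + g x)) /\
  mean (transfer q (fun x => H x + g x)) = 0.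
Proof.
move=> q1 bg g0 bH H0; have q0 : (0 < q)%N by exact: ltnW.
have m0 : mean (transfer q (fun x => H x + g x)) = 0.
  rewrite mean_transfer1//; last by case: (bl_add bH bg).
  by rewrite meanD ?H0 ?g0 ?addr0//; [case: bH|case: bg].
split => //; case: (bl_transfer q0 (bl_add bH bg)) => cT bT lT.
apply: bl_mean0 => // x y x01 y01.
apply: le_trans (lT _ _ x01 y01) _; rewrite ler_wpM2r//.
have e0 : 0 <= e.
  by apply: le_trans (normr_ge0 _) (bl_bound bg (x := 0) _); rewrite lexx ler01.
have q2 : 2 <= q%:R :> R by rewrite ler_nat.
by rewrite ler_pdivrMr ?ltr0n//; nra.
Qed.

(** One more summand: tilt by exp(g), push forward, renormalise by [N]. The invariant [near_density]
    returns with the same constants, so the errors do not accumulate along the sequence. *)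
Lemma density_step (R : realType) (e : R) (q : nat) (g H rho : R -> R)
    (N := mean (fun x => rho x * expR (g x))) :
  e <= 100^-1 -> (1 < q)%N -> bounded_lipschitz e e g -> mean g = 0 ->
  near_density e H rho ->
  [/\ 0 < N,
      `|ln N - (mean (fun x => g x ^+ 2) / 2 + mean (fun x => H x * g x))|
        <= 16 * e ^+ 3 &
      near_density e (transfer q (fun x => H x + g x))
        (fun v => N^-1 * transfer q (fun x => rho x * expR (g x)) v)].
Proof.
move=> e100 q1 bg g0 [bH H0 br crho rho1].
have q0 : (0 < q)%N by exact: ltnW.
have e0 : 0 <= e.
  by apply: le_trans (normr_ge0 _) (bl_bound bg (x := 0) _); rewrite lexx ler01.
have e2 : e <= 2^-1 by lra.
have ee : 0 <= e ^+ 2 by exact: sqr_ge0.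
have eee : 100 * e ^+ 3 <= e ^+ 2.
  by rewrite exprSr; nra.
have e4 : 100 * e ^+ 4 <= e ^+ 3.
  have : 0 <= e ^+ 3 by exact: exprn_ge0.
  by rewrite [e ^+ 4]exprSr; nra.
have e30 : 0 <= e ^+ 3 by exact: exprn_ge0.
have [bH' H'0] := first_order_step q1 bg g0 bH H0.
(* The product (1 + H + r)(1 + g + w) is expanded: [E3] collects the terms of order at least three,
   and [E] adds to them the second order terms w and H g. *)
set r := fun x => rho x - 1 - H x in br.
pose w := fun x => expR (g x) - 1 - g x.
have bw : bounded_lipschitz (2 * e ^+ 2) (2 * e ^+ 2) w := bl_expR2 e2 bg.
pose E3 := fun x => H x * w x + (r x * g x + r x * w x).
have bE3 := bl_add (bl_mul bH bw) (bl_add (bl_mul br bg) (bl_mul br bw)).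
pose E := fun x => w x + (H x * g x + E3 x).
(* In units of e^2, w contributes 2 to both bounds and H g contributes 1 to the supremum and 2 to
   the Lipschitz constant; one further unit absorbs [E3]. *)
have bE : bounded_lipschitz (4 * e ^+ 2) (5 * e ^+ 2) E.
  have := bl_add bw (bl_add (bl_mul bH bg) bE3).
  by apply: bl_le; rewrite -?exprD; nra.
have {}bE3 : bounded_lipschitz (13 * e ^+ 3) (27 * e ^+ 3) E3.
  by apply: bl_le bE3; nra.
have cg := bl_cont bg; have cH := bl_cont bH; have cr := bl_cont br.
have cw := bl_cont bw; have cE := bl_cont bE; have cE3 := bl_cont bE3.
have split_rho x : rho x * expR (g x) = 1 + (H x + g x) + (r x + E x).
  by rewrite /E /E3 /w /r; ring.
have cHg : continuous (fun x => H x + g x) by case: (bl_add bH bg).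
have crE : continuous (fun x => r x + E x) by case: (bl_add br bE).
have c1 : continuous (fun _ : R => 1 : R) by move=> ?; exact: cvg_cst.
have c1Hg : continuous (fun x => 1 + (H x + g x)).
  by move=> x; apply: cvgD; [exact: c1|exact: cHg].
have c1H : continuous (fun x => 1 + H x).
  by move=> x; apply: cvgD; [exact: c1|exact: cH].
(* The second order remainder of [rho] is centred, hence it enters [N] only through the third order
   terms. *)
have r0 : mean r = 0.
  have := meanD c1H cr; rewrite (meanD c1 cH) mean_cst H0.
  have -> : mean (fun x => 1 + H x + r x) = 1.
    by rewrite -[RHS]rho1; apply: eq_mean => x; rewrite /r; ring.
  by move=> K; lra.
have NE : N = 1 + mean E.
  rewrite /N (eq_mean split_rho) (meanD c1Hg crE) (meanD c1 cHg) mean_cst.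
  by rewrite (meanD cH cg) (meanD cr cE) H0 g0 r0 !(addr0, add0r).
have mE : `|mean E| <= 4 * e ^+ 2 by apply: ler_norm_mean => // x; exact: bl_bound bE x.
have e22 : e ^+ 2 <= 10000^-1 by nra.
have N0 : 0 < N.
  by move: mE e22; rewrite NE ler_norml; clear => /andP[? ?] ?; lra.
split => //.
  have cg2 := continuous_sqr cg.
  pose D := fun x => w x - g x ^+ 2 / 2.
  have cD : continuous D.
    by move=> x; apply: cvgB; [exact: cw|apply: cvgMr_tmp; exact: cg2].
  have cHxg : continuous (fun x => H x * g x) by case: (bl_mul bH bg).
  have mD : `|mean D| <= 2 * e ^+ 3.
    apply: ler_norm_mean => // x x01; apply: ler_norm_expR2 => //.
    exact: bl_bound bg x x01.
  have mE3 : `|mean E3| <= 13 * e ^+ 3.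
    by apply: ler_norm_mean => // x; exact: bl_bound bE3 x.
  have mEE : mean E = mean (fun x => g x ^+ 2) / 2 + mean (fun x => H x * g x)
      + (mean D + mean E3).
    have -> : mean E = mean (fun x => (2^-1 * g x ^+ 2 + D x) + (H x * g x + E3 x)).
      by apply: eq_mean => x; rewrite /E /D; ring.
    have c2 : continuous (fun x => 2^-1 * g x ^+ 2).
      by move=> x; apply: cvgMl_tmp; exact: cg2.
    rewrite meanD//; last 2 first.
    - by move=> x; apply: cvgD; [exact: c2|exact: cD].
    - by move=> x; apply: cvgD; [exact: cHxg|exact: cE3].
    by rewrite (meanD c2 cD) (meanD cHxg cE3) meanZ//; ring.
  have := @norm_ln1D _ (mean E); rewrite -NE.
  have lE : `|mean E| <= 2^-1 by apply: le_trans mE _; clear -e22; lra.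
  move=> /(_ lE) lnN.
  have sE : mean E ^+ 2 <= 16 * e ^+ 4.
    rewrite -real_normK ?num_real// (_ : 16 * e ^+ 4 = (4 * e ^+ 2) ^+ 2); last by ring.
    by rewrite ler_pXn2r// nnegrE mulr_ge0.
  (* Origin of 16: [D] costs 2 e^3, [E3] costs 13 e^3, and the logarithm costs 2 * 16 e^4, which is
     below e^3. *)
  move: e30 e4 sE lnN mD mE3; rewrite mEE.
  move: (ln N) (mean D) (mean E3) (_ / 2 + _) (_ ^+ 4) (_ ^+ 3); clear.
  move=> l d m s e4 e3 e30 e43; rewrite !ler_norml.
  by move=> sE /andP[? ?] /andP[? ?] /andP[? ?]; apply/andP; split; lra.
set T := transfer q (fun x => rho x * expR (g x)).
have crexp : continuous (fun x => rho x * expR (g x)).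
  move=> x; apply: cvgM; first exact: crho.
  by apply: cvg_comp; [exact: cg|exact: continuous_expR].
have cT : continuous T by exact: continuous_transfer.
have m1 : mean (fun v => N^-1 * T v) = 1.
  by rewrite meanZ// mean_transfer1// mulVf// gt_eqF.
have cNT : continuous (fun v => N^-1 * T v).
  by move=> x; apply: cvgMl_tmp; exact: cT.
split => //.
set H' := transfer q (fun x => H x + g x) in bH' H'0 *.
have cH' := bl_cont bH'.
(* The remainder of the new density after subtraction of 1 + H'. It is centred, so only its
   Lipschitz constant matters, and to that the constant term adds nothing. *)
pose r' := fun v => (N^-1 - 1) + ((N^-1 - 1) * H' v
  + N^-1 * transfer q (fun x => r x + E x) v).
have r'E v : N^-1 * T v - 1 - H' v = r' v.
  rewrite /r' /T.
  have -> : transfer q (fun x => rho x * expR (g x)) v =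
      1 + H' v + transfer q (fun x => r x + E x) v.
    rewrite (_ : (fun x => _) = (fun x => (1 + (H x + g x)) + (r x + E x))); last first.
      by apply/funext.
    rewrite (transferD q (fun x => 1 + (H x + g x))) (transferD q (fun=> 1)).
    by rewrite transfer_cst.
  by ring.
have mr' : mean r' = 0.
  rewrite -(eq_mean r'E).
  have -> : mean (fun v => N^-1 * T v - 1 - H' v) =
      mean (fun v => N^-1 * T v + (-1) * (1 + H' v)).
    by apply: eq_mean => v; ring.
  have c1H' : continuous (fun v => 1 + H' v).
    by move=> x; apply: cvgD; [exact: c1|exact: cH'].
  rewrite meanD//; last by move=> x; apply: cvgMl_tmp; exact: c1H'.
  by rewrite m1 meanZ// (meanD c1 cH') H'0 mean_cst; ring.
apply: (bl_eq (fun v => esym (r'E v))).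
have [cr' _ lr'] := bl_add (bl_cst (N^-1 - 1))
  (bl_add (bl_scale (N^-1 - 1) bH') (bl_scale N^-1 (bl_transfer q0 (bl_add br bE)))).
apply: bl_mean0 => // x y x01 y01.
apply: le_trans (lr' _ _ x01 y01) _; rewrite ler_wpM2r//.
have iN : N^-1 * N = 1 by rewrite mulVf// gt_eqF.
have iN0 : 0 < N^-1 by rewrite invr_gt0.
have N1 : `|N - 1| <= 4 * e ^+ 2 by rewrite NE addrC addKr.
have iN2 : N^-1 <= 1 + 1000^-1.
  by move: N1 e22 iN iN0; rewrite ler_norml; clear => /andP[? ?]; nra.
have iN1 : `|N^-1 - 1| <= 5 * e ^+ 2.
  have -> : N^-1 - 1 = - (N^-1 * (N - 1)) by rewrite mulrBr iN mulr1 opprB.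
  rewrite normrN normrM (gtr0_norm iN0).
  by have := normr_ge0 (N - 1); move: N1 iN2 iN0 ee; clear; nra.
(* This is why 10 reproduces itself: with q >= 2 the bound 10 + 5 drops to 15/2, which leaves room
   for the factor N^-1 and for the term in H'. *)
have d2 : (10 * e ^+ 2 + 5 * e ^+ 2) / q%:R <= (15 * e ^+ 2) / 2.
  rewrite -mulrDl (_ : 10 + 5 = 15 :> R); last by ring.
  rewrite ler_wpM2l ?mulr_ge0// lef_pV2 ?posrE ?ltr0n//.
  by rewrite ler_nat.
rewrite add0r (gtr0_norm iN0).
have d0 : 0 <= (10 * e ^+ 2 + 5 * e ^+ 2) / q%:R by rewrite divr_ge0// -mulrDl mulr_ge0.
have k1 : `|N^-1 - 1| * e <= 5 * e ^+ 3.
  by rewrite [e ^+ 3]exprSr mulrA ler_wpM2r.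
move: d0 d2 k1 iN2 iN0 eee ee; set dd := (X in 0 <= X); clear; nra.
Qed.

(** * Dilations, conditional expectations and second moments of lacunary sums *)

Lemma continuous_dilation (R : realType) (k : R) (psi : R -> R) :
  continuous psi -> continuous (fun u => psi (k * u)).
Proof.
move=> cpsi x; apply: (@cvg_comp _ _ _ (fun u : R => k * u) psi); last exact: cpsi.
by apply: cvgMl_tmp; exact: cvg_id.
Qed.

Lemma periodic_dilation (R : realType) (k : nat) (psi : R -> R) :
  (forall x, psi (x + 1) = psi x) ->
  forall x, psi (k%:R * (x + 1)) = psi (k%:R * x).
Proof. by move=> p x; rewrite mulrDr mulr1 periodic_nat. Qed.

(** Invariance of Lebesgue measure under u -> k u mod 1: duality with g = 1, as [transfer] fixes
    constants. *)
Lemma mean_dilation (R : realType) (k : nat) (psi : R -> R) : (0 < k)%N ->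
  continuous psi -> (forall x, psi (x + 1) = psi x) ->
  mean (fun u => psi (k%:R * u)) = mean psi.
Proof.
move=> k0 cpsi p.
have := @mean_transfer _ k (fun=> 1) psi k0 _ cpsi p.
rewrite (eq_mean (h := fun u => psi (k%:R * u))); last by move=> x; rewrite mul1r.
move=> ->; last by move=> ?; exact: cvg_cst.
by apply: eq_mean => x; rewrite transfer_cst// mul1r.
Qed.

Lemma lacunary_sum0 (R : realType) (g : R -> R) (a : nat -> nat) (u : R) :
  lacunary_sum g a 0 u = 0.
Proof. by rewrite /lacunary_sum big_geq. Qed.

Lemma lacunary_sumS (R : realType) (g : R -> R) (a : nat -> nat) (n : nat) (u : R) :
  lacunary_sum g a n.+1 u = lacunary_sum g a n u + g ((a n.+1)%:R * u).
Proof. by rewrite /lacunary_sum big_nat_recr. Qed.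

Lemma continuous_lacunary_sum (R : realType) (g : R -> R) (a : nat -> nat) (n : nat) :
  continuous g -> continuous (lacunary_sum g a n).
Proof.
move=> cg; elim: n => [|n IH] x.
  rewrite (_ : lacunary_sum g a 0 = fun=> 0); first exact: cvg_cst.
  by apply/funext => u; rewrite lacunary_sum0.
rewrite (_ : lacunary_sum g a n.+1 =
  fun u => lacunary_sum g a n u + g ((a n.+1)%:R * u)); last first.
  by apply/funext => u; rewrite lacunary_sumS.
by apply: cvgD; [exact: IH|exact: continuous_dilation].
Qed.

(* [response q g n] is the conditional expectation of [lacunary_sum g a n] given
   the fractional part of [a n.+1 * u], as a function of the latter. *)
Fixpoint response (R : realType) (q : nat -> nat) (g : R -> R) (n : nat) : R -> R :=
  if n is m.+1 then transfer (q m.+1) (fun x => response q g m x + g x)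
  else fun=> 0.

Lemma bl_response (R : realType) (e : R) (q : nat -> nat) (g : R -> R) (n : nat) :
  (forall n, (0 < n)%N -> (1 < q n)%N) ->
  bounded_lipschitz e e g -> mean g = 0 ->
  bounded_lipschitz e e (response q g n) /\ mean (response q g n) = 0.
Proof.
move=> q1 bg g0; elim: n => [|n [bH H0]] /=.
  have e0 : 0 <= e.
    by apply: le_trans (normr_ge0 _) (bl_bound bg (x := 0) _); rewrite lexx ler01.
  split; last exact: mean_cst.
  by apply: bl_le (bl_cst 0); rewrite ?normr0.
exact: first_order_step (q1 _ _) bg g0 bH H0.
Qed.

(** Induction over all test functions: psi(a_{n+2} u) is a test function of a_{n+1} u, namely v ->
    psi(q_{n+1} v), and duality then moves the factor q_{n+1} onto [transfer]. *)
Lemma mean_lacunary_sum_mul (R : realType) (e : R) (q a : nat -> nat)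
    (g psi : R -> R) (n : nat) :
  (0 < a 1)%N -> (forall n, (0 < n)%N -> (1 < q n)%N) ->
  (forall n, (0 < n)%N -> a n.+1 = q n * a n)%N ->
  bounded_lipschitz e e g -> mean g = 0 -> (forall x, g (x + 1) = g x) ->
  continuous psi -> (forall x, psi (x + 1) = psi x) ->
  mean (fun u => lacunary_sum g a n u * psi ((a n.+1)%:R * u)) =
  mean (fun x => response q g n x * psi x).
Proof.
move=> a1 q1 aq bg g0 pg; have cg := bl_cont bg.
have a0 m : (0 < a m.+1)%N.
  by elim: m => // m IH; rewrite aq// muln_gt0 IH ltnW// q1.
elim: n psi => [|n IH] psi cpsi ppsi.
  by apply: eq_mean => u; rewrite lacunary_sum0 !mul0r.
have q0 : (0 < q n.+1)%N by rewrite ltnW// q1.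
pose psi' v := psi ((q n.+1)%:R * v).
have cpsi' : continuous psi' by exact: continuous_dilation.
have ppsi' x : psi' (x + 1) = psi' x by exact: periodic_dilation.
have cH : continuous (response q g n) by case: (bl_response n q1 bg g0) => -[].
pose gp v := g v * psi' v.
have cgp : continuous gp by move=> x; apply: cvgM; [exact: cg|exact: cpsi'].
have -> : mean (fun u => lacunary_sum g a n.+1 u * psi ((a n.+2)%:R * u)) =
    mean (fun u => lacunary_sum g a n u * psi' ((a n.+1)%:R * u)
                   + gp ((a n.+1)%:R * u)).
  apply: eq_mean => u; rewrite lacunary_sumS mulrDl (aq n.+1)// natrM.
  by rewrite /gp /psi' !mulrA.
rewrite meanD; first last.
- exact: continuous_dilation.
- move=> x; apply: cvgM; first exact: continuous_lacunary_sum.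
  exact: continuous_dilation.
rewrite IH// mean_dilation//; last by move=> x; rewrite /gp pg ppsi'.
rewrite -meanD//; last by move=> x; apply: cvgM; [exact: cH|exact: cpsi'].
rewrite /= -mean_transfer//; last by move=> x; apply: cvgD; [exact: cH|exact: cg].
by apply: eq_mean => u; rewrite mulrDl.
Qed.

(** The square of the new summand is handled by invariance under dilation, the cross term by
    conditioning on a_{n+1} u. The increment is twice the main term in [density_step]. *)
Lemma second_momentS (R : realType) (e : R) (q a : nat -> nat)
    (g : R -> R) (n : nat) :
  (0 < a 1)%N -> (forall n, (0 < n)%N -> (1 < q n)%N) ->
  (forall n, (0 < n)%N -> a n.+1 = q n * a n)%N ->
  bounded_lipschitz e e g -> mean g = 0 -> (forall x, g (x + 1) = g x) ->
  mean (fun u => lacunary_sum g a n.+1 u ^+ 2) =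
  mean (fun u => lacunary_sum g a n u ^+ 2) +
  (mean (fun x => g x ^+ 2) + 2 * mean (fun x => response q g n x * g x)).
Proof.
move=> a1 q1 aq bg g0 pg; have cg := bl_cont bg.
have a0 m : (0 < a m.+1)%N.
  by elim: m => // m IH; rewrite aq// muln_gt0 IH ltnW// q1.
have cS := @continuous_lacunary_sum _ g a n cg.
have csq := @continuous_sqr R.
have cSg : continuous (fun u => lacunary_sum g a n u * g ((a n.+1)%:R * u)).
  by move=> x; apply: cvgM; [exact: cS|exact: continuous_dilation].
rewrite -(mean_lacunary_sum_mul n a1 q1 aq bg g0 pg cg pg) -(meanZ 2 cSg).
rewrite -(@mean_dilation _ (a n.+1) (fun x => g x ^+ 2))//; last 2 first.
- exact: csq.
- by move=> x; rewrite pg.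
have c1 : continuous (fun u : R => g ((a n.+1)%:R * u) ^+ 2).
  by apply: csq; exact: continuous_dilation.
have c2 : continuous (fun u : R => 2 * (lacunary_sum g a n u * g ((a n.+1)%:R * u))).
  by move=> x; apply: cvgMl_tmp; exact: cSg.
rewrite -(meanD c1 c2) -(meanD (csq _ cS)); last first.
  by move=> x; apply: cvgD; [exact: c1|exact: c2].
by apply: eq_mean => u; rewrite lacunary_sumS; ring.
Qed.

(** Each increment is at most e^2 + 2 e^2. The linear growth is needed for y_n / n -> 0. *)
Lemma second_moment_le (R : realType) (e : R) (q a : nat -> nat)
    (g : R -> R) (n : nat) :
  (0 < a 1)%N -> (forall n, (0 < n)%N -> (1 < q n)%N) ->
  (forall n, (0 < n)%N -> a n.+1 = q n * a n)%N ->
  bounded_lipschitz e e g -> mean g = 0 -> (forall x, g (x + 1) = g x) ->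
  mean (fun u => lacunary_sum g a n u ^+ 2) <= 3 * e ^+ 2 * n%:R.
Proof.
move=> a1 q1 aq bg g0 pg; elim: n => [|n IH].
  rewrite mulr0 -[leRHS](mean_cst (0 : R)) le_eqVlt; apply/orP; left.
  by apply/eqP/eq_mean => u; rewrite lacunary_sum0 expr0n.
rewrite (second_momentS n a1 q1 aq bg g0 pg) -(natr1 n) mulrDr mulr1 lerD//.
have [bH _] := bl_response n q1 bg g0.
have bgg := bl_mul bg bg; have bHg := bl_mul bH bg.
have m1 : mean (fun x => g x ^+ 2) <= e * e.
  apply: le_trans (ler_norm _) _; rewrite (eq_mean (h := fun x => g x * g x));
    last by move=> x; rewrite expr2.
  by apply: ler_norm_mean (bl_cont bgg) _ => x; exact: bl_bound bgg x.
have m2 : mean (fun x => response q g n x * g x) <= e * e.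
  apply: le_trans (ler_norm _) _.
  by apply: ler_norm_mean (bl_cont bHg) _ => x; exact: bl_bound bHg x.
by lra.
Qed.

Lemma log_laplace (R : realType) (e : R) (q a : nat -> nat)
    (g : R -> R) (n : nat) (M := mean (fun u => expR (lacunary_sum g a n u))) :
  e <= 100^-1 ->
  (0 < a 1)%N -> (forall n, (0 < n)%N -> (1 < q n)%N) ->
  (forall n, (0 < n)%N -> a n.+1 = q n * a n)%N ->
  bounded_lipschitz e e g -> mean g = 0 -> (forall x, g (x + 1) = g x) ->
  0 < M /\
  `|ln M - mean (fun u => lacunary_sum g a n u ^+ 2) / 2| <= 16 * e ^+ 3 * n%:R.
Proof.
move=> e100 a1 q1 aq bg g0 pg; have cg := bl_cont bg.
have a0 m : (0 < a m.+1)%N.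
  by elim: m => // m IH; rewrite aq// muln_gt0 IH ltnW// q1.
(* Strengthened induction: c is the Laplace transform itself (take psi = 1), and c * [rho] is the
   conditional expectation of exp(S_n) given a_{n+1} u mod 1, tested against periodic functions. *)
suff [rho [c [c0 nd mM lnc]]] : exists (rho : R -> R) (c : R), [/\ 0 < c,
    near_density e (response q g n) rho,
    forall psi : R -> R, continuous psi -> (forall x, psi (x + 1) = psi x) ->
      mean (fun u => expR (lacunary_sum g a n u) * psi ((a n.+1)%:R * u)) =
      c * mean (fun x => rho x * psi x) &
    `|ln c - mean (fun u => lacunary_sum g a n u ^+ 2) / 2| <= 16 * e ^+ 3 * n%:R].
  suff -> : M = c by [].
  have := mM (fun=> 1) (fun x => cvg_cst _) (fun=> erefl).
  rewrite (eq_mean (h := fun u => expR (lacunary_sum g a n u))); last first.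
    by move=> x; rewrite mulr1.
  rewrite -/M => ->; rewrite (eq_mean (h := rho)) ?(nd_mean nd) ?mulr1//.
  by move=> x; rewrite mulr1.
rewrite {}/M; elim: n => [|n [rho [c [c0 nd mM lnc]]]].
  exists (fun=> 1), 1; split => //.
  - have [b0 m0] := bl_response 0 q1 bg g0.
    split => //; last 2 first.
    + by move=> ?; exact: cvg_cst.
    + exact: mean_cst.
    apply: (@bl_eq _ _ _ (fun=> 0)); first by move=> x; rewrite subrr subr0.
    by apply: bl_le (bl_cst 0); rewrite ?normr0 mulr_ge0// sqr_ge0.
  - move=> psi cpsi ppsi; rewrite mul1r.
    transitivity (mean (fun u => psi ((a 1)%:R * u))).
      by apply: eq_mean => u; rewrite lacunary_sum0 expR0 mul1r.
    rewrite (mean_dilation (a0 0) cpsi ppsi).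
    by apply: eq_mean => x; rewrite mul1r.
  - rewrite ln1 (eq_mean (h := fun=> 0)); last first.
      by move=> u; rewrite lacunary_sum0 expr0n.
    by rewrite mean_cst mul0r subrr normr0 mulr0.
have [] := density_step e100 (q1 n.+1 isT) bg g0 nd.
set N := mean _ => N0 lnN nd'.
exists (fun v => N^-1 * transfer (q n.+1) (fun x => rho x * expR (g x)) v), (c * N).
have q0 : (0 < q n.+1)%N by rewrite ltnW// q1.
have crho := nd_cont nd.
have crhoe : continuous (fun x => rho x * expR (g x)).
  move=> x; apply: cvgM; first exact: crho.
  by apply: cvg_comp; [exact: cg|exact: continuous_expR].
split => //; first exact: mulr_gt0.
- move=> psi cpsi ppsi.
  (* The new factor exp(g(a_{n+1} u)) is absorbed into the test function before the induction
     hypothesis is applied. *)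
  pose psi' v := expR (g v) * psi ((q n.+1)%:R * v).
  have cpsi' : continuous psi'.
    move=> x; apply: cvgM; last exact: continuous_dilation.
    by apply: cvg_comp; [exact: cg|exact: continuous_expR].
  have ppsi' x : psi' (x + 1) = psi' x.
    by rewrite /psi' pg (periodic_dilation (q n.+1) ppsi).
  transitivity (mean (fun u => expR (lacunary_sum g a n u) * psi' ((a n.+1)%:R * u))).
    apply: eq_mean => u; rewrite lacunary_sumS expRD (aq n.+1)// natrM.
    by rewrite /psi' !mulrA.
  rewrite mM//.
  have -> : mean (fun x => rho x * psi' x) =
      mean (fun x => rho x * expR (g x) * psi ((q n.+1)%:R * x)).
    by apply: eq_mean => x; rewrite /psi' mulrA.
  rewrite mean_transfer// -mulrA; congr (_ * _).
  rewrite -meanZ; last first.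
    move=> x; apply: cvgM; last exact: cpsi.
    by apply: cvgMl_tmp; exact: continuous_transfer.
  by apply: eq_mean => x; rewrite !mulrA divff ?mul1r// gt_eqF.
- rewrite lnM ?posrE// (second_momentS n a1 q1 aq bg g0 pg) -(natr1 n) mulrDr mulr1.
  move: lnc lnN; rewrite !ler_norml => /andP[? ?] /andP[? ?].
  by apply/andP; split; lra.
Qed.

(** * Gaussian large deviations from moment generating functions *)

Definition mgf d (T : measurableType d) (R : realType) (P : probability T R)
    (X : T -> R) (l : R) : \bar R :=
  (\int[P]_w (expR (l * X w))%:E)%E.

Lemma measurable_expRM d (T : measurableType d) (R : realType) (X : T -> R) (l : R) :
  measurable_fun setT X -> measurable_fun setT (fun w => (expR (l * X w))%:E).
Proof.
move=> mX; apply/measurable_EFinP.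
by apply: measurableT_comp => //; exact: measurable_funM.
Qed.

(** On A, one of exp(l X) and exp(-l X) is at least exp(l b), so the indicator of A is at most
    exp(-l b) times their sum; both tails are treated at once. *)
Lemma chernoff2 d (T : measurableType d) (R : realType) (P : probability T R)
    (X : T -> R) (A : set T) (l b : R) :
  measurable_fun setT X -> measurable A -> 0 <= l ->
  (forall w, A w -> b <= `|X w|) ->
  (P A <= (expR (- (l * b)))%:E * (mgf P X l + mgf P X (- l)))%E.
Proof.
move=> mX mA l0 Ab; rewrite /mgf.
have m1 := measurable_expRM l mX; have m2 := measurable_expRM (- l) mX.
have p1 (k : R) (w : T) : setT w -> (0 <= (expR (k * X w))%:E)%E.
  by rewrite lee_fin expR_ge0.
rewrite -ge0_integralD//.
rewrite -ge0_integralZl//; last 2 first.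
- exact: emeasurable_funD.
- by move=> w _; rewrite adde_ge0// p1.
have -> : P A = (\int[P]_w (\1_A w)%:E)%E by rewrite integral_indic// setIT.
apply: ge0_le_integral => //.
- by apply/measurable_EFinP; exact: measurable_indic.
- by apply: emeasurable_funM => //; exact: emeasurable_funD.
- move=> w _; rewrite -EFinD -EFinM lee_fin indicE.
  have [Aw|_] := boolP (w \in A); last by rewrite mulr_ge0// ?addr_ge0 ?expR_ge0.
  rewrite mulrDr -!expRD; have := Ab w (set_mem Aw).
  have [X0|X0] := leP 0 (X w); [rewrite ger0_norm// => bX|rewrite ltr0_norm// => bX].
    apply: (@le_trans _ _ (expR (- (l * b) + l * X w))).
      by apply: le_trans (expR_ge1Dx _); rewrite lerDl; nra.
    by rewrite lerDl expR_ge0.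
  apply: (@le_trans _ _ (expR (- (l * b) + - l * X w))).
    by apply: le_trans (expR_ge1Dx _); rewrite lerDl; nra.
  by rewrite lerDr expR_ge0.
Qed.

(* Off the window [|X - c| < r] the density [exp (l X)] is dominated by the
   densities with parameters [l + k] and [l - k]. *)
Lemma mgf_window d (T : measurableType d) (R : realType) (P : probability T R)
    (X : T -> R) (A : set T) (l k c r : R) :
  measurable_fun setT X -> measurable A -> 0 <= k -> 0 <= r ->
  (forall w, `|X w - c| < r -> A w) ->
  (mgf P X l <= (expR (l * c + `|l| * r))%:E * P A
     + ((expR (- (k * (c + r))))%:E * mgf P X (l + k)
        + (expR (k * (c - r)))%:E * mgf P X (l - k)))%E.
Proof.
move=> mX mA k0 r0 Ac.
have m1 h := measurable_expRM h mX.
have p1 (h : R) (w : T) : setT w -> (0 <= (expR (h * X w))%:E)%E.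
  by rewrite lee_fin expR_ge0.
have e0 (h : R) : (0 <= (expR h)%:E)%E by rewrite lee_fin expR_ge0.
have i0 (w : T) : setT w -> (0 <= (\1_A w : R)%:E)%E by rewrite lee_fin.
have mi : measurable_fun setT (fun w => (\1_A w : R)%:E).
  by apply/measurable_EFinP; exact: measurable_indic.
have -> : P A = (\int[P]_w (\1_A w)%:E)%E by rewrite integral_indic// setIT.
have mZ (h : R) (g : T -> \bar R) :
  measurable_fun setT g -> measurable_fun setT (fun w => (expR h)%:E * g w)%E.
  by move=> mg; exact: emeasurable_funM.
have Zl (h : R) (g : T -> \bar R) : measurable_fun setT g ->
    (forall w, setT w -> (0 <= g w)%E) ->
    ((expR h)%:E * \int[P]_w g w = \int[P]_w ((expR h)%:E * g w))%E.
  by move=> mg g0; rewrite ge0_integralZl.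
have Z0 (h : R) (g : T -> \bar R) w : (0 <= g w)%E -> (0 <= (expR h)%:E * g w)%E.
  by move=> g0; rewrite mule_ge0.
rewrite /mgf (Zl _ _ mi i0) (Zl _ _ (m1 _) (p1 _)) (Zl _ _ (m1 _) (p1 _)).
rewrite -ge0_integralD//; try exact: mZ; try by move=> w _; apply: Z0; exact: p1.
have mD := emeasurable_funD (mZ (- (k * (c + r))) _ (m1 (l + k)))
  (mZ (k * (c - r)) _ (m1 (l - k))).
rewrite -ge0_integralD//; try exact: mZ; last first.
  by move=> w _; rewrite adde_ge0// mule_ge0// lee_fin expR_ge0.
apply: ge0_le_integral => //.
- by apply: emeasurable_funD => //; exact: mZ.
- move=> w _; rewrite -!EFinM -!EFinD lee_fin -!expRD.
  have q0 (h : R) := expR_ge0 h.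
  have [Aw|Aw] := ltP `|X w - c| r.
    rewrite indicE mem_set ?mulr1; last exact: Ac.
    apply: (@le_trans _ _ (expR (l * c + `|l| * r))); last by rewrite lerDl addr_ge0.
    rewrite ler_expR -lerBlDl -mulrBr (le_trans (ler_norm _))// normrM.
    by rewrite ler_wpM2l// ltW.
  have i1 : 0 <= expR (l * c + `|l| * r) * (\1_A w : R) by rewrite mulr_ge0.
  (* Right of the window k (X - c - r) >= 0, left of it k (c - r - X) >= 0; adding this to l X
     yields the two exponents. *)
  have [Xc|Xc] := leP 0 (X w - c).
    apply: (@le_trans _ _ (expR (- (k * (c + r)) + (l + k) * X w))).
      by rewrite ler_expR; rewrite ger0_norm// in Aw; nra.
    by rewrite addrA ler_wpDr// lerDr.
  apply: (@le_trans _ _ (expR (k * (c - r) + (l - k) * X w))).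
    by rewrite ler_expR; rewrite ltr0_norm// in Aw; nra.
  by rewrite addrA lerDr addr_ge0.
Qed.

Lemma limn_esup_le (R : realType) (u : nat -> \bar R) (c : \bar R) :
  (\forall n \near \oo, (u n <= c)%E) -> (limn_esup u <= c)%E.
Proof.
move=> uc; apply: ge_ereal_inf; exists (ereal_sup (u @` [set n | (u n <= c)%E])).
  by exists [set n | (u n <= c)%E].
by apply: ge_ereal_sup => _ [n un <-].
Qed.

Lemma le_limn_einf (R : realType) (u : nat -> \bar R) (c : \bar R) :
  (\forall n \near \oo, (c <= u n)%E) -> (c <= limn_einf u)%E.
Proof.
move=> uc; rewrite leeNr; apply: limn_esup_le.
by near=> n; rewrite leeN2; near: n.
Unshelve. all: by end_near. Qed.

Lemma near_ge_cvgy (R : realType) (x : nat -> R) (C : R) :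
  x n @[n --> \oo] --> +oo -> \forall n \near \oo, C <= x n.
Proof. by move=> /cvgryPge; exact. Qed.

(** Convergence of the scaled cumulant generating functions to l^2 / 2, written with exponentials to
    avoid logarithms of extended reals. *)
Definition gaussian_mgf_asymptotics d (T : measurableType d) (R : realType)
    (P : probability T R) (Z : nat -> T -> R) (x : nat -> R) : Prop :=
  forall l e : R, 0 < e -> \forall n \near \oo,
    ((expR (x n * (l ^+ 2 / 2 - e)))%:E
      <= mgf P (fun w => (x n * Z n w)%R) l
      <= (expR (x n * (l ^+ 2 / 2 + e)))%:E)%E.

Lemma lne_prob_le (R : realType) (p x v : R) : 0 < x -> 0 <= p ->
  p <= expR (x * v) -> (x^-1%:E * lne p%:E <= v%:E)%E.
Proof.
move=> x0 p0 pv; have [p_gt0|p_le0] := ltP 0 p.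
  rewrite lne_EFin// -EFinM lee_fin ler_pdivrMl//.
  by rewrite -(expRK (x * v)) ler_ln ?posrE ?expR_gt0.
have -> : lne p%:E = -oo%E by apply: le0_lneNy; rewrite lee_fin.
by rewrite gt0_muleNy ?leNye// lte_fin invr_gt0.
Qed.

Lemma le_lne_prob (R : realType) (p x v : R) : 0 < x ->
  expR (x * v) <= p -> (v%:E <= x^-1%:E * lne p%:E)%E.
Proof.
move=> x0 pv; have p0 : 0 < p := lt_le_trans (expR_gt0 _) pv.
rewrite lne_EFin// -EFinM lee_fin ler_pdivlMl//.
by rewrite -(expRK (x * v)) ler_ln ?posrE ?expR_gt0.
Qed.

(** Chernoff with the optimal parameter l = b: the exponent is -b^2 + b^2 / 2. Sets |t| >= b suffice
    because the rate function depends only on |t| and increases with it. *)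
Lemma gaussian_upper d (T : measurableType d) (R : realType)
    (P : probability T R) (Z : nat -> T -> R) (x : nat -> R) (B : set R) (b : R) :
  (forall n, (0 < n)%N -> measurable_fun setT (Z n)) ->
  (forall n, (0 < n)%N -> 0 < x n) -> x n @[n --> \oo] --> +oo ->
  gaussian_mgf_asymptotics P Z x -> measurable B -> 0 <= b ->
  (forall t, B t -> b <= `|t|) ->
  (limn_esup (fun n => (x n)^-1%:E * lne (P (Z n @^-1` B)))%E
    <= (- (b ^+ 2 / 2))%:E)%E.
Proof.
move=> mZ x0 xy as_mgf mB b0 Bb; apply/lee_addgt0Pr => e e0; apply: limn_esup_le.
have e2 : 0 < e / 2 by rewrite divr_gt0.
have ey : 0 < 4 / e by rewrite divr_gt0.
near=> n.
have n0 : (0 < n)%N by near: n; exists 1%N.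
have xn := x0 n n0.
have mA : measurable (Z n @^-1` B) by rewrite -[_ @^-1` _]setTI; exact: mZ.
have mX : measurable_fun setT (fun w => x n * Z n w).
  by apply: measurable_funM => //; exact: mZ.
have /andP[_ M1] : ((expR (x n * (b ^+ 2 / 2 - e / 2)))%:E
      <= mgf P (fun w => (x n * Z n w)%R) b
      <= (expR (x n * (b ^+ 2 / 2 + e / 2)))%:E)%E by near: n; exact: as_mgf.
have /andP[_ M2] : ((expR (x n * ((- b) ^+ 2 / 2 - e / 2)))%:E
      <= mgf P (fun w => (x n * Z n w)%R) (- b)
      <= (expR (x n * ((- b) ^+ 2 / 2 + e / 2)))%:E)%E by near: n; exact: as_mgf.
rewrite sqrrN in M2.
(* Half of the slack e pays for the generating functions; the other half, for such n, absorbs the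
   factor 2 from the two tails. *)
have xe : 4 / e <= x n by near: n; exact: near_ge_cvgy.
have := @chernoff2 _ _ _ P (fun w => x n * Z n w) (Z n @^-1` B) b (x n * b) mX mA b0.
have Xb w : (Z n @^-1` B) w -> x n * b <= `|x n * Z n w|.
  by move=> /Bb bZ; rewrite normrM (gtr0_norm xn) ler_pM2l.
move=> /(_ Xb) PA.
have {}PA : (P (Z n @^-1` B) <= (expR (x n * (- (b ^+ 2 / 2) + e)))%:E)%E.
  apply: (le_trans PA); apply: (@le_trans _ _ ((expR (- (b * (x n * b))))%:E *
    ((expR (x n * (b ^+ 2 / 2 + e / 2)))%:E
     + (expR (x n * (b ^+ 2 / 2 + e / 2)))%:E))%E).
    by rewrite lee_wpmul2l ?lee_fin ?expR_ge0// leeD.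
  rewrite -EFinD -EFinM lee_fin mulrDr -expRD.
  have -> : x n * (- (b ^+ 2 / 2) + e) =
    (- (b * (x n * b)) + x n * (b ^+ 2 / 2 + e / 2)) + x n * e / 2 by field.
  have e2x : 2 <= expR (x n * e / 2).
    by apply: le_trans (expR_ge1Dx _); move: xe; rewrite ler_pdivrMr//; lra.
  rewrite [leRHS]expRD.
  have := expR_ge0 (- (b * (x n * b)) + x n * (b ^+ 2 / 2 + e / 2)).
  by move: (expR (_ + _)) => K K0; nra.
rewrite -EFinD; have := PA.
have -> : P (Z n @^-1` B) = (fine (P (Z n @^-1` B)))%:E.
  by rewrite fineK// fin_num_measure.
rewrite lee_fin => {}PA; apply: lne_prob_le => //.
by rewrite fine_ge0.
Unshelve. all: by end_near. Qed.

(** Tilting with parameter t centres Z_n at t. By [mgf_window] with shift k = r, the tilted mass at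
    distance at least r from t is exponentially negligible, so the window carries at least half of
    it. *)
Lemma gaussian_lower d (T : measurableType d) (R : realType)
    (P : probability T R) (Z : nat -> T -> R) (x : nat -> R) (B : set R) (t : R) :
  (forall n, (0 < n)%N -> measurable_fun setT (Z n)) ->
  (forall n, (0 < n)%N -> 0 < x n) -> x n @[n --> \oo] --> +oo ->
  gaussian_mgf_asymptotics P Z x -> measurable B -> interior B t ->
  ((- (t ^+ 2 / 2))%:E <=
    limn_einf (fun n => (x n)^-1%:E * lne (P (Z n @^-1` B)))%E)%E.
Proof.
move=> mZ x0 xy as_mgf mB; rewrite /interior/= => /nbhs_ballP[r0 /= r00 Br0].
apply/lee_subgt0Pr => e e0; rewrite -EFinB; apply: le_limn_einf.
(* The window must lie in B, and replacing Z_n by t inside it must cost at most |t| r <= e / 2 in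
   the exponent. *)
pose r := Num.min r0 (e / (2 * (`|t| + 1))).
have t1 : 0 < 2 * (`|t| + 1) by rewrite mulr_gt0// ltr_wpDl.
have r_gt0 : 0 < r by rewrite lt_min r00 divr_gt0.
have tr : `|t| * r <= e / 2.
  have : r <= e / (2 * (`|t| + 1)) by rewrite ge_min lexx orbT.
  by rewrite ler_pdivlMr//; have := normr_ge0 t; nra.
(* The tolerance h must fit in the budget e and stay well below the gap r^2 / 2 between the window
   and the tails. *)
pose h := Num.min (e / 4) (r ^+ 2 / 8).
have r2 : 0 < r ^+ 2 by rewrite exprn_gt0.
have h0 : 0 < h by rewrite lt_min !divr_gt0.
have he : h <= e / 4 by rewrite ge_min lexx.
have hr : h <= r ^+ 2 / 8 by rewrite ge_min lexx orbT.
have BZ n w : `|x n * Z n w - x n * t| < x n * r -> 0 < x n -> (Z n @^-1` B) w.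
  move=> + xn; rewrite -mulrBr normrM (gtr0_norm xn) ltr_pM2l// => Zt.
  apply: Br0; rewrite /ball/= distrC; apply: lt_le_trans Zt _.
  by rewrite ge_min lexx.
near=> n.
have n0 : (0 < n)%N by near: n; exists 1%N.
have xn := x0 n n0.
have mA : measurable (Z n @^-1` B) by rewrite -[_ @^-1` _]setTI; exact: mZ.
have mX : measurable_fun setT (fun w => x n * Z n w).
  by apply: measurable_funM => //; exact: mZ.
have /andP[M1 _] : ((expR (x n * (t ^+ 2 / 2 - h)))%:E
      <= mgf P (fun w => (x n * Z n w)%R) t
      <= (expR (x n * (t ^+ 2 / 2 + h)))%:E)%E by near: n; exact: as_mgf.
have /andP[_ M2] : ((expR (x n * ((t + r) ^+ 2 / 2 - h)))%:E
      <= mgf P (fun w => (x n * Z n w)%R) (t + r)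
      <= (expR (x n * ((t + r) ^+ 2 / 2 + h)))%:E)%E by near: n; exact: as_mgf.
have /andP[_ M3] : ((expR (x n * ((t - r) ^+ 2 / 2 - h)))%:E
      <= mgf P (fun w => (x n * Z n w)%R) (t - r)
      <= (expR (x n * ((t - r) ^+ 2 / 2 + h)))%:E)%E by near: n; exact: as_mgf.
have xr : 12 / r ^+ 2 <= x n by near: n; exact: near_ge_cvgy.
have xe : 4 / e <= x n by near: n; exact: near_ge_cvgy.
have xr0 : 0 <= x n * r by rewrite mulr_ge0// ltW.
have := @mgf_window _ _ _ P (fun w => x n * Z n w) (Z n @^-1` B) t r (x n * t) (x n * r)
  mX mA (ltW r_gt0) xr0 (fun w K => BZ n w K xn).
have -> : P (Z n @^-1` B) = (fine (P (Z n @^-1` B)))%:E.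
  by rewrite fineK// fin_num_measure.
set p := fine _.
have e_ge0 (v : R) : (0 <= (expR v)%:E)%E by rewrite lee_fin expR_ge0.
move=> W; have {W} := le_trans M1 (le_trans W (leeD (lexx _) (leeD
  (lee_wpmul2l (e_ge0 _) M2) (lee_wpmul2l (e_ge0 _) M3)))).
rewrite -!EFinM -!EFinD lee_fin -!expRD => W.
apply: le_lne_prob => //.
set E0 := expR (x n * (t ^+ 2 / 2 - h)) in W.
(* The exponents differ by x_n (r^2 / 2 - 2 h) >= x_n r^2 / 4 >= 3, and exp(3) >= 4; the two tails
   together take at most half of [E0]. *)
have small : 4 * expR (x n * (t ^+ 2 / 2 - r ^+ 2 / 2 + h)) <= E0.
  have -> : E0 = expR (x n * (t ^+ 2 / 2 - r ^+ 2 / 2 + h)) *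
      expR (x n * (r ^+ 2 / 2 - 2 * h)).
    by rewrite /E0 -expRD; congr expR; ring.
  rewrite mulrC ler_wpM2l ?expR_ge0//; apply: le_trans (expR_ge1Dx _).
  by move: xr; rewrite ler_pdivrMr//; nra.
have q1 : - (r * (x n * t + x n * r)) + x n * ((t + r) ^+ 2 / 2 + h) =
    x n * (t ^+ 2 / 2 - r ^+ 2 / 2 + h) by field.
have q2 : r * (x n * t - x n * r) + x n * ((t - r) ^+ 2 / 2 + h) =
    x n * (t ^+ 2 / 2 - r ^+ 2 / 2 + h) by field.
rewrite q1 q2 in W.
have Kp : E0 / 2 <= expR (t * (x n * t) + `|t| * (x n * r)) * p by lra.
have p0 : 0 <= p by rewrite fine_ge0.
rewrite -(ler_pM2l (expR_gt0 (t * (x n * t) + `|t| * (x n * r)))).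
apply: le_trans Kp; rewrite ler_pdivlMr// -expRD.
(* The budget e is spent as e / 2 on the window width, e / 4 on h and e / 4 on the factor 2. *)
have h2 : 2 <= expR (x n * e / 4).
  apply: le_trans (expR_ge1Dx _); move: xe; rewrite ler_pdivrMr//; lra.
apply: (@le_trans _ _ (expR (t * (x n * t) + `|t| * (x n * r)
                             + x n * (- (t ^+ 2 / 2) - e)) * expR (x n * e / 4))).
  by rewrite ler_wpM2l ?expR_ge0.
rewrite -expRD /E0 ler_expR.
have -> : t * (x n * t) + `|t| * (x n * r) + x n * (- (t ^+ 2 / 2) - e) + x n * e / 4
  = x n * (t ^+ 2 / 2 + `|t| * r - 3 / 4 * e) by field.
by rewrite ler_pM2l//; lra.
Unshelve. all: by end_near. Qed.

Lemma gaussian_LDP d (T : measurableType d) (R : realType)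
    (P : probability T R) (Z : nat -> T -> R) (x : nat -> R) :
  (forall n, (0 < n)%N -> measurable_fun setT (Z n)) ->
  (forall n, (0 < n)%N -> 0 < x n) -> x n @[n --> \oo] --> +oo ->
  gaussian_mgf_asymptotics P Z x ->
  LDP P Z x (fun t : R => (t ^+ 2 / 2)%:E).
Proof.
move=> mZ x0 xy as_mgf; split => //.
- by move=> t; rewrite lee_fin divr_ge0// sqr_ge0.
- move=> s; have Icont : continuous (fun t : R => t ^+ 2 / 2).
    by move=> t; apply: cvgMr_tmp; apply: (@continuous_sqr R id) => u; exact: cvg_id.
  (* If t^2 <= 2 s then |t| <= |s| + 1, because (|s| + 1)^2 >= 2 |s|. *)
  apply: (@subclosed_compact _ _ `[- (`|s| + 1), `|s| + 1]).
  + rewrite (_ : mkset _ = (fun t : R => t ^+ 2 / 2) @^-1` [set u | u <= s]).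
      by apply: closed_comp => [t _|]; [exact: Icont|exact: closed_le].
    by apply/seteqP; split => t /=; rewrite lee_fin.
  + exact: segment_compact.
  + move=> t /=; rewrite lee_fin in_itv/= => ts.
    by have := ler_norm s; rewrite -ler_norml; have := normr_ge0 s;
      have := normr_ge0 t; have := real_normK (num_real t); nra.
- move=> B mB u; split.
  + rewrite leeNl; apply: le_ereal_inf_tmp => _ [t Bt <-].
    by rewrite leeNl; exact: gaussian_lower.
  + exact: limn_einf_sup.
  + have up (b : R) := @gaussian_upper _ _ _ P Z x B b mZ x0 xy as_mgf mB.
    have Ic t : B t ->
      (ereal_inf [set (t ^+ 2 / 2)%:E | t in closure B] <= (t ^+ 2 / 2)%:E)%E.
      move=> Bt; apply: ge_ereal_inf; exists (t ^+ 2 / 2)%:E => //.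
      by exists t => //; exact: subset_closure.
    (* For a finite infimum s >= 0, B lies in |t| >= sqrt(2 s). An infimum +oo forces B to be empty,
       and then every b >= 0 is admissible, so the upper limit is -oo. *)
    case: ereal_inf Ic => [s| |] Ic.
    * have [s0|s0] := leP 0 s.
        have -> : (- s%:E)%E = (- ((Num.sqrt (2 * s)) ^+ 2 / 2))%:E.
          by rewrite sqr_sqrtr ?mulr_ge0// mulrAC divff// mul1r.
        apply: up; first exact: sqrtr_ge0.
        move=> t /Ic; rewrite lee_fin => st.
        by rewrite -sqrtr_sqr ler_wsqrtr//; lra.
      apply: (@le_trans _ _ 0%E); last by rewrite lee_fin oppr_ge0 ltW.
      by have := up 0 (lexx _) (fun t _ => normr_ge0 t); rewrite expr0n/= mul0r oppr0.
    * have B0 t : B t -> False by move=> /Ic.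
      have {up} : forall b : R, 0 <= b -> (limn_esup u <= (- (b ^+ 2 / 2))%:E)%E.
        by move=> b b0; apply: up => // t /B0.
      case: (limn_esup u) => [v| |] up //; last by have := up 0 (lexx _).
      have v0 := normr_ge0 v; have vv : - v <= `|v| by rewrite -normrN ler_norm.
      have : v <= - ((`|v| + 2) ^+ 2 / 2) by rewrite -lee_fin up// addr_ge0.
      by move=> K; exfalso; nra.
    * exact: leey.
Qed.

(** * Even trigonometric polynomials *)

Lemma periodic_cos_int (R : realType) (k : int) (x : R) :
  cos (2 * pi * k%:~R * (x + 1)) = cos (2 * pi * k%:~R * x).
Proof.
have P (n : nat) (y : R) : cos (2 * pi * n%:R * (y + 1)) = cos (2 * pi * n%:R * y).
  have -> : 2 * pi * n%:R * (y + 1) = 2 * pi * n%:R * y + pi *+ 2 *+ n.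
    by rewrite -[pi *+ 2 *+ n]mulr_natr -[pi *+ 2]mulr_natr; ring.
  by rewrite periodicn//; exact: cosD2pi.
case: k => n; first exact: P.
by rewrite NegzE mulrNz mulrN !mulNr !cosN; exact: P.
Qed.

Lemma bl_cos (R : realType) (b : R) :
  bounded_lipschitz 1 `|b| (fun x => cos (b * x)).
Proof.
split => [|x x01|x y x01 y01].
- exact/continuous_dilation/continuous_cos.
- by rewrite ler_norml cos_geN1 cos_le1.
- have dcos (s : R) : is_derive s (1 : R) cos (- sin s) by exact: is_derive_cos.
  have sin1 (s : R) : `|s| <= Num.max `|b * x| `|b * y| -> `|- sin s| <= 1.
    by rewrite normrN sin_max.
  rewrite -normrM mulrBr -[leRHS]mul1r.
  by apply: (ler_dist_derive dcos sin1); rewrite le_max lexx ?orbT.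
Qed.

(** Real parts are taken on both sides; since the coefficients are real, only the cosines
    survive. *)
Lemma trigpoly_cosE (R : realType) (f : R -> R) : even_real_trigpoly f ->
  exists (D : nat) (c : nat -> R) (k : nat -> int),
    forall x, f x = \sum_(j < D) c j * cos (2 * pi * (k j)%:~R * x).
Proof.
move=> [D [c [_ _ fE]]].
exists D.*2.+1, (fun k => c (k%:Z - D%:Z)), (fun k => k%:Z - D%:Z) => x.
have := congr1 (@complex.Re R) (fE x) => /= ->.
rewrite (big_morph (@complex.Re R) (id1 := 0) (op1 := +%R))//; last by case=> ? ? [].
by apply: eq_bigr => k _ /=; rewrite mul0r subr0.
Qed.

Lemma bl_cos_sum (R : realType) (D : nat) (c : nat -> R) (k : nat -> int) :
  exists B L : R, bounded_lipschitz B L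
    (fun x => \sum_(j < D) c j * cos (2 * pi * (k j)%:~R * x)).
Proof.
elim: D => [|D [B [L IH]]].
  by exists `|0 : R|, 0; apply: bl_eq (bl_cst 0) => x; rewrite big_ord0.
have := bl_add IH (bl_scale (c D) (bl_cos (2 * pi * (k D)%:~R))).
set B' := (X in bounded_lipschitz X); set L' := (X in bounded_lipschitz _ X) => K.
by exists B', L'; apply: bl_eq K => x; rewrite big_ord_recr.
Qed.

Lemma trigpoly_regular (R : realType) (f : R -> R) : even_real_trigpoly f ->
  (forall x, f (x + 1) = f x) /\ exists2 F : R, 0 <= F & bounded_lipschitz F F f.
Proof.
move=> /trigpoly_cosE[D [c [k fE]]]; split.
  by move=> x; rewrite !fE; apply: eq_bigr => j _; rewrite periodic_cos_int.
have [B [L bl]] := bl_cos_sum D c k; exists (`|B| + `|L|); first by rewrite addr_ge0.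
apply: (bl_eq (fun x => esym (fE x))); apply: bl_le bl.
  by rewrite (le_trans (ler_norm _))// lerDl.
by rewrite (le_trans (ler_norm _))// lerDr.
Qed.

(** * Application to lacunary sums of a uniform random variable *)

Lemma integral_uniform_comp d (T : measurableType d) (R : realType)
    (P : probability T R) (U : {RV P >-> R}) (phi : R -> R) :
  (forall B : set R, measurable B ->
     distribution P U B = uniform_prob (@ltr01 R) B) ->
  continuous phi -> (forall x, 0 <= phi x) ->
  (\int[P]_w (phi (U w))%:E = (mean phi)%:E)%E.
Proof.
move=> hU cphi phi0.
have mU0 : measurable_fun setT U by exact: measurable_funPT.
have mU : measurable_fun setT (U : T -> measurableTypeR R) by move=> mT Y; exact: mU0.
pose U' : {RV P >-> measurableTypeR R} := HB.pack (U : T -> measurableTypeR R)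
  (isMeasurableFun.Build _ _ _ _ (U : T -> measurableTypeR R) mU).
have mphi : measurable_fun setT (fun x : measurableTypeR R => (phi x)%:E).
  by apply/measurable_EFinP; exact: continuous_measurable_fun.
have phi0' (x : measurableTypeR R) : (0 <= (phi x)%:E)%E by rewrite lee_fin.
transitivity (\int[distribution P U']_x (phi x)%:E)%E.
  by rewrite (ge0_integral_distribution U' mphi phi0').
transitivity (\int[uniform_prob (@ltr01 R)]_x (phi x)%:E)%E.
  by apply: eq_measure_integral => A mA _; exact: hU.
rewrite integral_uniform// subr0 invr1 mul1e /mean /Rintegral fineK//.
exact: integrable_fin_num (continuous_itv_integrable 0 1 cphi).
Qed.

Lemma lacunary_sumZ (R : realType) (t : R) (f : R -> R)
    (a : nat -> nat) (n : nat) (u : R) :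
  lacunary_sum (fun x => t * f x) a n u = t * lacunary_sum f a n u.
Proof. by rewrite /lacunary_sum mulr_sumr. Qed.

Lemma ratio_quotient (a : nat -> nat) (n : nat) : (0 < a n)%N ->
  (exists2 q : nat, (2 <= q)%N & (a n.+1)%:R / (a n)%:R = q%:R :> rat) ->
  (1 < a n.+1 %/ a n)%N /\ a n.+1 = (a n.+1 %/ a n * a n)%N.
Proof.
move=> an0 [q q2 aq].
have E : a n.+1 = (q * a n)%N.
  have an0' : (a n)%:R != 0 :> rat by rewrite pnatr_eq0 -lt0n.
  by apply/eqP; rewrite -(eqr_nat rat) natrM -aq mulfVK.
by rewrite E mulnK.
Qed.

(** With s = sqrt(z_n), l x_n Z_n = l s S_n is the lacunary sum of g = l s f, so [log_laplace]
    applies with e = s |l| F. Its error 16 (s K)^3 n has an extra factor s compared with z_n n,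
    hence is o(x_n). *)
Lemma lacunary_mgf_asymptotics d (T : measurableType d) (R : realType)
    (P : probability T R) (U : {RV P >-> R}) (q a : nat -> nat) (f : R -> R)
    (F c : R) (z : nat -> R)
    (V := fun n => mean (fun u => lacunary_sum f a n u ^+ 2)) :
  (forall B : set R, measurable B ->
     distribution P U B = uniform_prob (@ltr01 R) B) ->
  (0 < a 1)%N -> (forall n, (0 < n)%N -> (1 < q n)%N) ->
  (forall n, (0 < n)%N -> a n.+1 = q n * a n)%N ->
  0 <= F -> bounded_lipschitz F F f -> mean f = 0 ->
  (forall x, f (x + 1) = f x) ->
  0 < c -> (forall n, (0 < n)%N -> c * n%:R <= V n) ->
  (forall n, (0 < n)%N -> 0 < z n) -> z n @[n --> \oo] --> (0 : R) ->
  gaussian_mgf_asymptotics P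
    (fun n w => lacunary_sum f a n (U w) / (Num.sqrt (z n) * V n))
    (fun n => z n * V n).
Proof.
move=> hU a1 q1 aq F0 bf f0 pf c0 Vc z0 zto0 l e e0.
pose K := `|l| * F.
have K0 : 0 <= K by rewrite mulr_ge0.
have K3 : 0 <= K ^+ 3 by rewrite exprn_ge0.
(* For s <= D the first bound gives s K <= 1/100, the second s * 16 K^3 <= c e. The summands 1 keep
   the denominators positive when K = 0. *)
pose D := Num.min (100 * (K + 1))^-1 (c * e / (16 * K ^+ 3 + 1)).
have D1 : 0 < 100 * (K + 1) by lra.
have D2 : 0 < 16 * K ^+ 3 + 1 by lra.
have D0 : 0 < D by rewrite lt_min invr_gt0 D1 divr_gt0// mulr_gt0.
near=> n.
have n0 : (0 < n)%N by near: n; exists 1%N.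
have nR : 0 < n%:R :> R by rewrite ltr0n.
have zn := z0 n n0.
have Vn : 0 < V n by apply: lt_le_trans (Vc n n0); rewrite mulr_gt0.
have s0 : 0 < Num.sqrt (z n) by rewrite sqrtr_gt0.
have sz : Num.sqrt (z n) ^+ 2 = z n by rewrite sqr_sqrtr// ltW.
have zD : `|z n| <= D ^+ 2.
  near: n; have /cvgr0Pnorm_le := zto0; apply.
  by rewrite exprn_gt0.
have sD : Num.sqrt (z n) <= D.
  by have := ler_wsqrtr zD; rewrite sqrtr_sqr !gtr0_norm.
set s := Num.sqrt (z n) in s0 sz sD *.
have sK : s * K <= 100^-1.
  have : s <= (100 * (K + 1))^-1 by apply: le_trans sD _; rewrite ge_min lexx.
  rewrite -[_^-1]mul1r ler_pdivlMr//; nra.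
have sc : s * (16 * K ^+ 3) <= c * e.
  have : s <= c * e / (16 * K ^+ 3 + 1).
    by apply: le_trans sD _; rewrite ge_min lexx orbT.
  rewrite ler_pdivlMr//; nra.
pose g x := l * s * f x.
have nls : `|l * s| * F = s * K by rewrite normrM (gtr0_norm s0) /K; ring.
have bg : bounded_lipschitz (s * K) (s * K) g by rewrite -nls; exact: bl_scale.
have cf := bl_cont bf.
have g0 : mean g = 0 by rewrite meanZ// f0 mulr0.
have pg x : g (x + 1) = g x by rewrite /g pf.
have [M0 lnM] := log_laplace n sK a1 q1 aq bg g0 pg.
set M := mean _ in M0 lnM.
have -> : mgf P (fun w => z n * V n * (lacunary_sum f a n (U w) / (s * V n))) l = M%:E.
  rewrite /M -(integral_uniform_comp hU); last 2 first.
  - move=> x; apply: cvg_comp; last exact: continuous_expR.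
    exact: (@continuous_lacunary_sum _ _ _ _ (bl_cont bg)).
  - by move=> x; exact: expR_ge0.
  apply: eq_integral => w _; congr (_%:E); congr expR.
  rewrite lacunary_sumZ -sz; field.
  by rewrite !gt_eqF.
have V2 : mean (fun u => lacunary_sum g a n u ^+ 2) = l ^+ 2 * (z n * V n).
  have -> : mean (fun u => lacunary_sum g a n u ^+ 2) =
      mean (fun u => (l * s) ^+ 2 * lacunary_sum f a n u ^+ 2).
    by apply: eq_mean => u; rewrite lacunary_sumZ exprMn.
  rewrite meanZ; first by rewrite exprMn sz mulrA.
  exact: continuous_sqr (@continuous_lacunary_sum _ _ _ _ cf).
have err : 16 * (s * K) ^+ 3 * n%:R <= e * (z n * V n).
  have -> : 16 * (s * K) ^+ 3 * n%:R = z n * n%:R * (s * (16 * K ^+ 3)).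
    by rewrite -sz; ring.
  apply: (@le_trans _ _ (z n * n%:R * (c * e))).
    by rewrite ler_wpM2l// mulr_ge0// ltW.
  have -> : z n * n%:R * (c * e) = e * (z n * (c * n%:R)) by ring.
  by rewrite ler_wpM2l ?(ltW e0)// ler_wpM2l ?(ltW zn)// Vc.
rewrite !lee_fin -[M]lnK ?posrE// !ler_expR.
move: lnM; rewrite V2 ler_norml => /andP[? ?].
by apply/andP; split; lra.
Unshelve. all: by end_near. Qed.

Theorem theorem1 (R : realType) (d : measure_display) (T : measurableType d)
    (P : probability T R) (U : {RV P >-> R})
    (hU : forall B : set R, measurable B ->
       distribution P U B = uniform_prob (@ltr01 R) B)
    (a : nat -> nat)
    (a_gt0 : forall n, (0 < n)%N -> (0 < a n)%N)
    (a_ratio : forall n, (0 < n)%N ->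
       exists2 q : nat, (2 <= q)%N & (a n.+1)%:R / (a n)%:R = q%:R :> rat)
    (f : R -> R)
    (hf : even_real_trigpoly f)
    (f_neq0 : exists x, f x <> 0)
    (f_mean0 : Rintegral (@lebesgue_measure R) `[0, 1] f = 0)
    (S := fun (n : nat) (w : T) => lacunary_sum f a n (U w))
    (var_lb : exists2 c : R, 0 < c &
       forall n, (0 < n)%N ->
         ((c * n%:R)%:E <= 'E_P[(fun w => S n w ^+ 2)%R])%E)
    (z : nat -> R)
    (z_gt0 : forall n, (0 < n)%N -> 0 < z n)
    (z_to0 : z n @[n --> \oo] --> (0 : R))
    (zn_toy : z n * n%:R @[n --> \oo] --> +oo)
    (zlog_to0 : z n * ln (n%:R : R) ^+ 2 @[n --> \oo] --> (0 : R))
    (x := fun n : nat => z n * fine 'E_P[(fun w => S n w ^+ 2)%R])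
    (y := fun n : nat => Num.sqrt (z n) * fine 'E_P[(fun w => S n w ^+ 2)%R]) :
  MDP P S y x (fun t : R => (t ^+ 2 / 2)%:E).
Proof.
have [pf [F F0 bf]] := trigpoly_regular hf.
have cf := bl_cont bf.
pose q n := (a n.+1 %/ a n)%N.
have q1 n : (0 < n)%N -> (1 < q n)%N.
  by move=> n0; have [] := ratio_quotient (a_gt0 n n0) (a_ratio n n0).
have aq n : (0 < n)%N -> a n.+1 = (q n * a n)%N.
  by move=> n0; have [] := ratio_quotient (a_gt0 n n0) (a_ratio n n0).
have a1 : (0 < a 1)%N by exact: a_gt0.
pose V n := mean (fun u => lacunary_sum f a n u ^+ 2).
have cS n : continuous (lacunary_sum f a n) by exact: continuous_lacunary_sum.
have EV n : ('E_P[(fun w => S n w ^+ 2)%R] = (V n)%:E)%E.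
  rewrite unlock; apply: (integral_uniform_comp
    (phi := fun u => lacunary_sum f a n u ^+ 2) hU).
    exact: continuous_sqr.
  by move=> u; exact: sqr_ge0.
have [c c0 Ec] := var_lb.
have Vc n : (0 < n)%N -> c * n%:R <= V n by move=> /Ec; rewrite EV lee_fin.
have VF n : V n <= 3 * F ^+ 2 * n%:R.
  exact: second_moment_le a1 q1 aq bf f_mean0 pf.
have -> : x = (fun n => z n * V n) by apply/funext => n; rewrite /x EV.
have -> : y = (fun n => Num.sqrt (z n) * V n) by apply/funext => n; rewrite /y EV.
have sz n : (0 < n)%N -> Num.sqrt (z n) ^+ 2 = z n.
  by move=> n0; rewrite sqr_sqrtr// ltW// z_gt0.
have s0 n : (0 < n)%N -> 0 < Num.sqrt (z n) by move=> n0; rewrite sqrtr_gt0 z_gt0.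
have Vn n : (0 < n)%N -> 0 < V n.
  by move=> n0; apply: lt_le_trans (Vc n n0); rewrite mulr_gt0// ltr0n.
have znA (A : R) : \forall n \near \oo, A / c <= z n * n%:R.
  by apply: near_ge_cvgy.
have z1 : \forall n \near \oo, `|z n| <= 1 by have /cvgr0Pnorm_le := z_to0; apply.
(* From x_n >= c z_n n. *)
have cxy : z n * V n @[n --> \oo] --> +oo.
  apply/cvgryPge => A; near=> n.
  have n0 : (0 < n)%N by near: n; exists 1%N.
  have : A / c <= z n * n%:R by near: n; exact: znA.
  rewrite ler_pdivrMr// => /le_trans; apply.
  by rewrite -mulrA ler_wpM2l ?(ltW (z_gt0 _ n0))// mulrC Vc.
split.
(* Eventually z_n <= 1, so sqrt(z_n) >= z_n and y_n >= x_n. *)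
- apply/cvgryPge => A; near=> n.
  have n0 : (0 < n)%N by near: n; exists 1%N.
  have zn1 : `|z n| <= 1 by near: n.
  have : A <= z n * V n by near: n; exact: near_ge_cvgy.
  move=> /le_trans; apply; rewrite ler_wpM2r ?(ltW (Vn _ n0))//.
  rewrite gtr0_norm ?z_gt0// in zn1.
  have := s0 _ n0; have := sz _ n0; set s := Num.sqrt _ => <- s_gt0.
  have s1 : s ^+ 2 <= 1 by rewrite /s sz.
  by nra.
(* Here y_n / n <= 3 F^2 sqrt(z_n), which tends to 0. *)
- have F1 : 0 < 3 * F ^+ 2 + 1 by have := sqr_ge0 F; lra.
  apply/cvgr0Pnorm_le => e e0; near=> n.
  have n0 : (0 < n)%N by near: n; exists 1%N.
  have nR : 0 < n%:R :> R by rewrite ltr0n.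
  have zn : `|z n| <= (e / (3 * F ^+ 2 + 1)) ^+ 2.
    near: n; move/cvgr0Pnorm_le: z_to0; apply.
    by rewrite exprn_gt0// divr_gt0.
  have sn : Num.sqrt (z n) <= e / (3 * F ^+ 2 + 1).
    have e1 : 0 <= e / (3 * F ^+ 2 + 1) by rewrite ltW// divr_gt0.
    by have := ler_wsqrtr zn; rewrite sqrtr_sqr (ger0_norm e1) gtr0_norm ?z_gt0.
  rewrite gtr0_norm; last by rewrite divr_gt0// mulr_gt0 ?s0 ?Vn.
  rewrite ler_pdivrMr//; apply: (@le_trans _ _ (Num.sqrt (z n) * (3 * F ^+ 2 * n%:R))).
    by rewrite ler_wpM2l// ltW// s0.
  rewrite mulrA ler_wpM2r ?(ltW nR)//.
  move: sn; rewrite ler_pdivlMr//; have := s0 _ n0; nra.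
(* Here y_n / sqrt(n) >= c sqrt(z_n n), which tends to infinity. *)
- apply/cvgryPge => A; near=> n.
  have n0 : (0 < n)%N by near: n; exists 1%N.
  have nR : 0 < n%:R :> R by rewrite ltr0n.
  have sn0 : 0 < Num.sqrt n%:R :> R by rewrite sqrtr_gt0.
  have zA : (A / c) ^+ 2 <= z n * n%:R by near: n; exact: near_ge_cvgy.
  rewrite ler_pdivlMr//.
  have : `|A / c| <= Num.sqrt (z n) * Num.sqrt n%:R.
    by rewrite -sqrtr_sqr -sqrtrM ?ler_wsqrtr// ltW// z_gt0.
  move=> /(le_trans (ler_norm _)); rewrite ler_pdivrMr// => Asn.
  apply: (@le_trans _ _ (Num.sqrt (z n) * (c * n%:R))); last first.
    by rewrite ler_wpM2l ?Vc// ltW// s0.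
  rewrite -[n%:R in leRHS]sqr_sqrtr ?(ltW nR)// expr2.
  rewrite [leRHS](_ : _ = Num.sqrt (z n) * Num.sqrt n%:R * c * Num.sqrt n%:R);
    last by ring.
  by rewrite ler_wpM2r// ltW.
- apply: gaussian_LDP => //.
  + move=> n n0; apply: measurable_funM => //.
    apply: measurableT_comp; last exact: measurable_funPT.
    exact: continuous_measurable_fun.
  + by move=> n n0; rewrite mulr_gt0 ?z_gt0 ?Vn.
  + exact: lacunary_mgf_asymptotics hU a1 q1 aq F0 bf f_mean0 pf c0 Vc z_gt0 z_to0.
Unshelve. all: by end_near. Qed.
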